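(* Let $\Omega=D_1\times D_2\subset\mathbb C^2$ be a Cartesian product of bounded connected planar domains containing $0$, and suppose $$\partial D_1\times\partial D_2\subset S^3(R).$$ Let $\mathcal F$ be a one-dimensional holomorphic foliation, holomorphic near $\overline\Omega$ and complex tangent to $S^3(R)$ along $\partial D_1\times\partial D_2$. Then there exist $a,b>0$, $a^2+b^2=R^2$, such that $$D_1=\{|x|<a\},\qquad D_2=\{|y|<b\},$$ and, for a local generator $X$ of $\mathcal F$ near $0$, $$X=h(x,y)\left(b^2x\frac{\partial}{\partial x}-a^2y\frac{\partial}{\partial y}\right)$$ with $h$ holomorphic; if $0$ is an isolated nondegenerate singularity, then $h$ is a unit.
   Context: $(x,y)$ are the standard coordinates of $\mathbb C^2$, each of $D_1,D_2\subset\mathbb C$ contains $0$, and $S^3(R)=\{|x|^2+|y|^2=R^2\}$, $R>0$. $\mathcal F$ is complex tangent to $S^3(R)$ at $p$ if its tangent line at $p$ is contained in the complex tangent line $T_p^{\mathbb C}S^3(R)$; for a generator $X=P\,\partial_x+Q\,\partial_y$ this means $\overline xP+\overline yQ=0$ at $p$. A singularity is nondegenerate if the linear part of a generator there is invertible. A unit is a holomorphic germ that does not vanish at $0$. *)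

(* Defs.v *)
From HB Require Import structures.
From mathcomp Require Import all_boot all_order all_algebra.
From mathcomp Require Import all_classical all_reals all_analysis.
From mathcomp Require Import complex.

Set Implicit Arguments.
Unset Strict Implicit.
Unset Printing Implicit Defensive.

Import Order.TTheory GRing.Theory Num.Theory numFieldNormedType.Exports.

Local Open Scope classical_set_scope.
Local Open Scope ring_scope.
Local Open Scope complex_scope.

(* The alias _^o carries the norm topology and the structure of a normed
   module over R[i]; hence [differentiable] below is complex (Frechet)
   differentiability, and norms are elements of R[i]. *)
Notation Cpx R := ((complex (Real.sort R))^o).
Notation Cpx2 R := (Cpx R * Cpx R)%type.

Section Definitions.
Variable R : realType.
Local Notation C := (Cpx R).
Local Notation C2 := (Cpx2 R).
Implicit Types (U W : set C2) (p : C2).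

Definition planar_domain (D : set C) : Prop :=
  [/\ open D, connected D & bounded_set D].

Definition bdry (D : set C) : set C := closure D `\` interior D.

Definition sphere (r : R) : set C2 :=
  [set p | `|p.1| ^+ 2 + `|p.2| ^+ 2 = (r ^+ 2)%:C :> R[i]].

Definition holomorphic_on (V : normedModType R[i]) W (f : C2 -> V) : Prop :=
  open W /\ forall p, W p -> differentiable f p.

(* A vector field P d/dx + Q d/dy is the map p |-> (P p, Q p).

   A (possibly singular) one-dimensional foliation on U is an invertible
   subsheaf of the holomorphic tangent sheaf, given by an atlas of local
   generators, unique up to multiplication by nowhere vanishing functions.
   The zeros of a generator form a set with empty interior; they are not
   required to be isolated. *)
Record foliation U := Foliation {
  chart : Type;
  chart_dom : chart -> set C2;
  chart_gen : chart -> C2 -> C2;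
  chart_cover : \bigcup_i chart_dom i = U;
  chart_gen_holomorphic : forall i, holomorphic_on (chart_dom i) (chart_gen i);
  chart_gen_nontrivial : forall i W,
    open W -> W !=set0 -> W `<=` chart_dom i ->
    exists2 p, W p & chart_gen i p != 0;
  chart_gen_compatible : forall i j, exists g : C2 -> C,
    holomorphic_on (chart_dom i `&` chart_dom j) g /\
    forall p, chart_dom i p -> chart_dom j p ->
      g p != 0 /\ chart_gen i p = g p *: chart_gen j p }.

Section FoliationNotions.
Variables (U : set C2) (F : foliation U).

Definition local_generator p (X : C2 -> C2) : Prop :=
  exists W, [/\ W p, W `<=` U, holomorphic_on W X &
    forall i : chart F, exists g : C2 -> C,
      holomorphic_on (W `&` chart_dom i) g /\
      forall q, W q -> chart_dom i q -> g q != 0 /\ X q = g q *: chart_gen i q].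

Definition singular_point p : Prop :=
  exists2 X, local_generator p X & X p = 0.

Definition isolated_singularity p : Prop :=
  singular_point p /\ \forall q \near p^', ~ singular_point q.

Definition nondegenerate_singularity p : Prop :=
  exists2 X, local_generator p X & bijective ('d X p : C2 -> C2).

(* The span of X p for a generator X. At a singular point, where there is no
   tangent line, this is {0}, so that tangency is vacuous there. *)
Definition tangent_line p : set C2 :=
  [set v | exists2 X, local_generator p X & exists c : R[i], v = c *: X p].

End FoliationNotions.

(* Kernel of the real differential of |x|^2 + |y|^2 at p, which is
   2 Re (x^* dx + y^* dy). *)
Definition sphere_tangent p : set C2 :=
  [set v | complex.Re ((p.1 : R[i])^* * v.1 + (p.2 : R[i])^* * v.2) = 0].

(* The maximal complex subspace T `&` iT of the real tangent space T; it is
   the set of v such that x^* v.1 + y^* v.2 = 0. *)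
Definition complex_sphere_tangent p : set C2 :=
  [set v | sphere_tangent p v /\ sphere_tangent p ('i *: v)].

Definition complex_tangent_at U (F : foliation U) (r : R) p : Prop :=
  [/\ U p, sphere r p & tangent_line F p `<=` complex_sphere_tangent p].

(* b^2 x d/dx - a^2 y d/dy *)
Definition linear_field (a b : R) (p : C2) : C2 :=
  ((b ^+ 2)%:C * p.1, - (a ^+ 2)%:C * p.2).

(* Germs of functions at p are represented by functions near p. *)
Definition holomorphic_germ p (h : C2 -> C) : Prop :=
  \forall q \near p, differentiable h q.

Definition unit_germ p (h : C2 -> C) : Prop :=
  holomorphic_germ p h /\ h p != 0.

End Definitions.

(* Main.v *)
Require Import Defs.
From HB Require Import structures.
From mathcomp Require Import all_boot all_order all_algebra.
From mathcomp Require Import all_classical all_reals all_analysis.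
From mathcomp Require Import complex.
From mathcomp Require Import ring lra.

Set Implicit Arguments.
Unset Strict Implicit.
Unset Printing Implicit Defensive.
Import Order.TTheory GRing.Theory Num.Theory numFieldNormedType.Exports.
Import Normc.

Local Open Scope classical_set_scope.
Local Open Scope ring_scope.
Local Open Scope complex_scope.

(** Why the theorem holds.

    The boundaries.  On [bdry D1 `*` bdry D2] the sum of |x|^2 and |y|^2 is
    constant, so |x| is a constant a on [bdry D1] and |y| is a constant b on
    [bdry D2].  A bounded open set containing 0 whose boundary lies on a circle
    about 0 is the open disc ([disc_of_circular_bdry]): a radial segment
    leaving the set has to meet its boundary.

    The foliation.  Let X = (P, Q) be a generator.  Tangency to the sphere on
    the torus |x| = a, |y| = b says that the function
    a^2 y P + b^2 x Q ([tangency]) vanishes there.  Changing the generator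
    multiplies this function by a nowhere vanishing one, so the set of points
    near which it vanishes identically ([tangent_near]) depends on the
    foliation only.  This set is open; by the identity theorem in two variables
    ([identity_box]) it is closed in U and contains the point (a, b) of the
    torus.  Hence it contains the whole segment from (a, b) to the origin
    ([tangent_near_origin]), and no global generator is needed.  Near the origin
    the relation a^2 y P + b^2 x Q = 0 makes P divisible by x and Q by y, with
    the same quotient h up to constants ([coordinate_syzygy]); this is
    X = h (b^2 x d/dx - a^2 y d/dy).  If h vanished at 0, the derivative at 0 of
    every generator would kill (1, 0) ([diff_multiple_linear_field]), which
    nondegeneracy forbids.

    The function theory.  Only complex differentiability is available, so the
    complex analysis starts from Goursat's theorem for rectangles ([goursat]),
    stated for the imaginary part of the integral, which suffices.  It gives a
    crude estimate of the value at a centre ([center_le2]).  Applied to powers,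
    the estimate sharpens to a maximum principle that moreover tolerates
    finitely many points of mere continuity ([max_principle]).  Everything else
    follows by applying the maximum principle to divided differences
    ([dslope]): dividing by many zeros yields the identity theorem
    ([identity_disc]), and the boundedness of second differences
    ([second_difference]) yields first order expansions with a quadratic error
    ([linear_approx]).  These expansions along lines show that a point is
    removable for functions of two variables continuous there
    ([removable_origin]),
    which is what makes h differentiable at the origin. *)

(** * Integrals over segments *)

Section SegmentIntegral.
Variable R : realType.
Implicit Types (f g : R -> R) (a b c k : R).

(** The integral of f over the segment [[a, b]]; it is only used for [a <= b]. *)
Definition sint f a b : R := \int[lebesgue_measure]_(x in `[a, b]) f x.

(** Continuity of f, as a function on the whole line, at each point of
    [[a, b]]. *)
Definition cont_seg f a b := forall x, a <= x <= b -> {for x, continuous f}.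

Lemma cont_segW f a b c d : a <= c -> d <= b -> cont_seg f a b -> cont_seg f c d.
Proof. by move=> ac db h x /andP[cx xd]; apply: h; rewrite (le_trans ac cx) (le_trans xd db). Qed.

Lemma cont_segB f g a b :
  cont_seg f a b -> cont_seg g a b -> cont_seg (fun x => f x - g x) a b.
Proof.
move=> hf hg x xab.
by apply: (@continuousB _ R^o R^o _ _ x); [exact: hf|exact: hg].
Qed.

Lemma cont_seg_integrable f a b : cont_seg f a b ->
  (@lebesgue_measure R).-integrable `[a, b] (EFin \o f).
Proof.
move=> h; apply: continuous_compact_integrable; first exact: segment_compact.
apply: continuous_in_subspaceT => x; rewrite inE/= in_itv/= => xab.
exact: h.
Qed.

Lemma sint_cat f a b c : a <= b -> b <= c -> cont_seg f a c ->
  sint f a c = sint f a b + sint f b c.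
Proof.
move=> ab bc h; have hi := cont_seg_integrable h.
have := @Rintegral_itvB R f (BLeft a) (BRight c) b hi.
rewrite !bnd_simp => /(_ ab bc) /eqP; rewrite subr_eq addrC => /eqP.
rewrite Rintegral_itv_obnd_cbnd; first by [].
apply: integrableS hi => //.
by apply: subset_itvr; rewrite bnd_simp.
Qed.

Lemma sintB f g a b : cont_seg f a b -> cont_seg g a b ->
  sint (fun x => f x - g x) a b = sint f a b - sint g a b.
Proof. by move=> hf hg; rewrite /sint RintegralB//; exact: cont_seg_integrable. Qed.

Lemma sint_ge f a b k : a <= b -> cont_seg f a b ->
  (forall x, a <= x <= b -> k <= f x) -> k * (b - a) <= sint f a b.
Proof.
move=> ab hf kf.
have <- : sint (fun=> k) a b = k * (b - a).
  rewrite /sint Rintegral_cst//= lebesgue_measure_itv/= lte_fin.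
  case: ltgtP ab => [||->] //= _.
  by rewrite ?subrr ?mulr0.
apply: le_Rintegral => //.
- by apply: cont_seg_integrable => x _; exact: cst_continuous.
- exact: cont_seg_integrable.
Qed.

Lemma sint_le f a b k : a <= b -> cont_seg f a b ->
  (forall x, a <= x <= b -> f x <= k) -> sint f a b <= k * (b - a).
Proof.
move=> ab hf kf.
have <- : sint (fun=> k) a b = k * (b - a).
  rewrite /sint Rintegral_cst//= lebesgue_measure_itv/= lte_fin.
  case: ltgtP ab => [||->] //= _.
  by rewrite ?subrr ?mulr0.
apply: le_Rintegral => //.
- exact: cont_seg_integrable.
- by apply: cont_seg_integrable => x _; exact: cst_continuous.
Qed.
End SegmentIntegral.

(** * Real-valued moduli and differentiability *)

(** The norm of [R[i]] takes its values in [R[i]], whose order is partial.  All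
    the estimates below are carried out in [R], with the modulus [normc]. *)

Section Bridges.
Variable R : realType.
Local Notation C := (Cpx R).

Lemma norm_normc (z : C) : `|z| = (normc z)%:C.
Proof. by []. Qed.

Lemma normc_ge0 (z : R[i]) : 0 <= normc z.
Proof. by case: z => a b /=; exact: sqrtr_ge0. Qed.

Lemma normc_eq0 (z : R[i]) : (normc z == 0) = (z == 0).
Proof. by apply/eqP/eqP => [/eq0_normc//|->]; exact: (normc0 R). Qed.

Lemma normc_gt0 (z : R[i]) : (0 < normc z) = (z != 0).
Proof. by rewrite lt_neqAle normc_ge0 andbT eq_sym normc_eq0. Qed.

Lemma normcBC (x y : R[i]) : normc (x - y) = normc (y - x).
Proof. by rewrite -normcN opprB. Qed.

Lemma normc_real (k : R) : normc k%:C = `|k|.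
Proof. by rewrite /= expr0n/= addr0 sqrtr_sqr. Qed.

Lemma normcX (z : R[i]) n : normc (z ^+ n) = normc z ^+ n.
Proof. by elim: n => [|n ih]; rewrite ?expr0 ?normc1// !exprS normcM ih. Qed.

Lemma normRe_le (z : R[i]) : `|complex.Re z| <= normc z.
Proof. by rewrite -lecR; exact: normc_ge_Re. Qed.

Lemma normIm_le (z : R[i]) : `|complex.Im z| <= normc z.
Proof.
case: z => a b /=; rewrite -sqrtr_sqr ler_wsqrtr//.
by rewrite lerDr sqr_ge0.
Qed.

Lemma normc_le_ReIm (z : R[i]) : normc z <= `|complex.Re z| + `|complex.Im z|.
Proof.
case: z => a b /=.
rewrite -[leRHS]ger0_norm ?addr_ge0// -sqrtr_sqr ler_wsqrtr//.
rewrite sqrrD !real_normK ?num_real//.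
by rewrite lerD2r lerDl mulrn_wge0// mulr_ge0.
Qed.

Lemma nbhs_normc (z : R[i]) (P : set C) :
  nbhs (z : C) P <-> exists2 d : R, 0 < d & forall z' : R[i], normc (z' - z) < d -> P z'.
Proof.
split=> [/nbhs_ballP[e /= e0 h]|[d d0 h]].
  have eE : e = (complex.Re e)%:C.
    by rewrite RRe_real// gtr0_real.
  exists (complex.Re e); first by rewrite -ltcR -eE.
  move=> z' zz'; apply: h; rewrite -ball_normE /ball_/= -normrN opprB.
  by rewrite eE norm_normc ltcR.
apply/nbhs_ballP; exists d%:C => /=; first by rewrite ltcR.
move=> z'; rewrite -ball_normE /ball_/= -normrN opprB norm_normc ltcR.
exact: h.
Qed.

Lemma continuous_normcP (f : R[i] -> R[i]) (z : R[i]) :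
  {for (z : C), continuous (f : C -> C)} <->
  forall e : R, 0 < e -> exists2 d : R, 0 < d &
    forall z' : R[i], normc (z' - z) < d -> normc (f z' - f z) < e.
Proof.
split=> [h e e0|h].
  have : nbhs (f z : C) [set z' : C | normc (z' - f z) < e].
    by apply/nbhs_normc; exists e.
  by move=> /h /nbhs_normc.
move=> A /nbhs_normc[e e0 he]; apply/nbhs_normc.
by have [d d0 hd] := h _ e0; exists d => // z' /hd; exact: he.
Qed.

Lemma differentiable_nearP (K : numFieldType) (V W : normedModType K) (f : V -> W) x :
  differentiable f x ->
  forall e : K, 0 < e -> \forall h \near (0 : V), `|f (h + x) - f x - 'd f x h| <= e * `|h|.
Proof.
move=> df e e0.
have := diff_locally df => H.
have : (f \o shift x) = cst (f x) + 'd f x +o_ 0 id by [].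
move=> /eqaddoP /(_ _ e0); apply: filterS => h /=.
by rewrite !fctE opprD addrA.
Qed.

Lemma near_differentiable (K : numFieldType) (V W : normedModType K) (f : V -> W) x
   (L : {linear V -> W}) : continuous L ->
  (forall e : K, 0 < e -> \forall h \near (0 : V), `|f (h + x) - f x - L h| <= e * `|h|) ->
  differentiable f x.
Proof.
move=> cL H.
have E : f \o shift x = cst (f x) + L +o_ 0 id.
  apply/eqaddoP => e e0; have := H e e0; apply: filterS => h.
  by rewrite /= !fctE opprD addrA.
by apply/diff_locallyP; rewrite (diff_unique cL E).
Qed.

Lemma differentiable_normcP (f : R[i] -> R[i]) (z : R[i]) :
  differentiable (f : C -> C) (z : C) <->
  exists d : R[i], forall e : R, 0 < e -> exists2 r : R, 0 < r &
    forall z' : R[i], normc (z' - z) < r ->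
      normc (f z' - f z - d * (z' - z)) <= e * normc (z' - z).
Proof.
split.
  move=> df; exists ('d (f : C -> C) (z : C) 1) => e e0.
  have e0' : 0 < e%:C by rewrite ltcR.
  have /nbhs_normc[r r0 hr] := differentiable_nearP df e0'.
  exists r => // z' zr.
  have := hr (z' - z); rewrite subr0 => /(_ zr).
  have -> : ('d (f : C -> C) (z : C) (z' - z : C)) = ('d (f : C -> C) (z : C) 1 : R[i]) * (z' - z).
    have : 'd (f : C -> C) (z : C) ((z' - z : R[i]) *: (1 : C)) =
      (z' - z : R[i]) *: ('d (f : C -> C) (z : C) 1) by rewrite linearZ.
    by rewrite /GRing.scale/= mulr1 mulrC.
  have -> : (z' - z : C) + z = z' by exact: subrK.
  by rewrite !norm_normc -rmorphM lecR.
case=> d H.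
have lin_scal : linear (fun h : C => h *: (d : C)).
  by move=> ? ? ?; rewrite scalerDl scalerA.
pose scallM := GRing.isLinear.Build _ _ _ _ _ lin_scal.
pose scalL : {linear C -> C} := HB.pack (fun h : C => h *: (d : C)) scallM.
apply: (@near_differentiable _ _ _ _ _ scalL); first exact: scalel_continuous.
move=> e e0.
have eE : e = (complex.Re e)%:C by rewrite RRe_real// gtr0_real.
have e0' : 0 < complex.Re e by rewrite -ltcR -eE.
have [r r0 hr] := H _ e0'.
apply/nbhs_normc; exists r => // h; rewrite subr0 => hh.
have := hr (h + z); rewrite addrK => /(_ hh).
by rewrite eE !norm_normc -rmorphM lecR mulrC.
Qed.

End Bridges.

(** * Goursat's theorem for rectangles *)

Section Goursat.
Variable R : realType.
Local Notation C := (Cpx R).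
Implicit Types (f : R[i] -> R[i]) (s t : R).

Lemma cont_seg_comp f (F : R[i] -> R) (g : R -> R[i]) a b :
  (forall z z', `|F z - F z'| <= normc (z - z')) ->
  (forall s s', normc (g s - g s') <= `|s - s'|) ->
  (forall s, a <= s <= b -> {for (g s : C), continuous (f : C -> C)}) ->
  cont_seg (F \o f \o g) a b.
Proof.
move=> hF hg hf s sab; apply/cvgrPdist_lt => e e0.
have /continuous_normcP /(_ _ e0)[d d0 hd] := hf _ sab.
apply/nbhs_ballP; exists d => //= s' /= ss'.
apply: le_lt_trans (hF _ _) _; rewrite normcBC; apply: hd.
by apply: le_lt_trans (hg _ _) _; rewrite distrC.
Qed.

(** The imaginary part of the integral of [f(z) dz] along the boundary of the
    rectangle [[s0, s1] x [t0, t1]], oriented counterclockwise. *)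
Definition oint f s0 s1 t0 t1 : R :=
  sint (fun s => complex.Im (f (s +i* t0)) - complex.Im (f (s +i* t1))) s0 s1 +
  sint (fun t => complex.Re (f (s1 +i* t)) - complex.Re (f (s0 +i* t))) t0 t1.

(** Continuity of f at the points of a horizontal, resp. vertical, segment. *)
Definition cont_hor f t a b :=
  forall s, a <= s <= b -> {for (s +i* t : C), continuous (f : C -> C)}.
Definition cont_ver f s a b :=
  forall t, a <= t <= b -> {for (s +i* t : C), continuous (f : C -> C)}.

Lemma cont_segIm f t a b : cont_hor f t a b ->
  cont_seg (fun s => complex.Im (f (s +i* t))) a b.
Proof.
move=> h; apply: (@cont_seg_comp f (@complex.Im R) (fun s => s +i* t)) => //.
  by move=> z z'; rewrite -raddfB; exact: normIm_le.
by move=> s s' /=; rewrite subrr expr0n/= addr0 sqrtr_sqr.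
Qed.

Lemma cont_segRe f s a b : cont_ver f s a b ->
  cont_seg (fun t => complex.Re (f (s +i* t))) a b.
Proof.
move=> h; apply: (@cont_seg_comp f (@complex.Re R) (fun t => s +i* t)) => //.
  by move=> z z'; rewrite -raddfB; exact: normRe_le.
by move=> t t' /=; rewrite subrr expr0n/= add0r sqrtr_sqr.
Qed.

Lemma oint_cat_hor f s0 s1 s2 t0 t1 : s0 <= s1 -> s1 <= s2 ->
  cont_hor f t0 s0 s2 -> cont_hor f t1 s0 s2 ->
  cont_ver f s0 t0 t1 -> cont_ver f s1 t0 t1 -> cont_ver f s2 t0 t1 ->
  oint f s0 s2 t0 t1 = oint f s0 s1 t0 t1 + oint f s1 s2 t0 t1.
Proof.
move=> s01 s12 /cont_segIm h0 /cont_segIm h1.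
move=> /cont_segRe v0 /cont_segRe v1 /cont_segRe v2.
rewrite /oint (sint_cat s01 s12); last exact: cont_segB.
rewrite !sintB//; first by ring.
all: by [apply: cont_segW h0|apply: cont_segW h1].
Qed.

Lemma oint_cat_ver f s0 s1 t0 t1 t2 : t0 <= t1 -> t1 <= t2 ->
  cont_ver f s0 t0 t2 -> cont_ver f s1 t0 t2 ->
  cont_hor f t0 s0 s1 -> cont_hor f t1 s0 s1 -> cont_hor f t2 s0 s1 ->
  oint f s0 s1 t0 t2 = oint f s0 s1 t0 t1 + oint f s0 s1 t1 t2.
Proof.
move=> t01 t12 /cont_segRe h0 /cont_segRe h1.
move=> /cont_segIm v0 /cont_segIm v1 /cont_segIm v2.
rewrite /oint (sint_cat t01 t12); last exact: cont_segB.
rewrite !sintB//; first by ring.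
all: by [apply: cont_segW h0|apply: cont_segW h1].
Qed.

(** Complex differentiability at each point of a closed rectangle. *)
Definition diff_rect f s0 s1 t0 t1 := forall s t, s0 <= s <= s1 -> t0 <= t <= t1 ->
  differentiable (f : C -> C) (s +i* t : C).

Lemma diff_rect_hor f s0 s1 t0 t1 t : diff_rect f s0 s1 t0 t1 ->
  t0 <= t <= t1 -> cont_hor f t s0 s1.
Proof. by move=> h tt s ss; apply: differentiable_continuous; exact: h. Qed.

Lemma diff_rect_ver f s0 s1 t0 t1 s : diff_rect f s0 s1 t0 t1 ->
  s0 <= s <= s1 -> cont_ver f s t0 t1.
Proof. by move=> h ss t tt; apply: differentiable_continuous; exact: h. Qed.

Lemma diff_rectW f s0 s1 t0 t1 s0' s1' t0' t1' : s0 <= s0' -> s1' <= s1 ->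
  t0 <= t0' -> t1' <= t1 -> diff_rect f s0 s1 t0 t1 -> diff_rect f s0' s1' t0' t1'.
Proof.
move=> a b c d h s t /andP[s0s ss1] /andP[t0t tt1]; apply: h.
  by rewrite (le_trans a s0s) (le_trans ss1 b).
by rewrite (le_trans c t0t) (le_trans tt1 d).
Qed.

(** One of the four quarters carries at least a quarter of the integral. *)
Lemma oint_quarter f s0 s1 t0 t1 : s0 <= s1 -> t0 <= t1 -> diff_rect f s0 s1 t0 t1 ->
  exists s t, [/\ s0 <= s, s + (s1 - s0) / 2 <= s1, t0 <= t, t + (t1 - t0) / 2 <= t1 &
    `|oint f s0 s1 t0 t1| <=
      4 * `|oint f s (s + (s1 - s0) / 2) t (t + (t1 - t0) / 2)|].
Proof.
move=> s01 t01 h.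
pose s := s0 + (s1 - s0) / 2; pose t := t0 + (t1 - t0) / 2.
have s0s : s0 <= s by rewrite /s; lra.
have ss1 : s <= s1 by rewrite /s; lra.
have t0t : t0 <= t by rewrite /t; lra.
have tt1 : t <= t1 by rewrite /t; lra.
have s1E : s + (s1 - s0) / 2 = s1 by rewrite /s; field.
have t1E : t + (t1 - t0) / 2 = t1 by rewrite /t; field.
have hor t' a b : t0 <= t' <= t1 -> s0 <= a -> b <= s1 -> cont_hor f t' a b.
  move=> tt aa bb x /andP[ax xb]; apply: (diff_rect_hor h tt).
  by rewrite (le_trans aa ax) (le_trans xb bb).
have ver s' a b : s0 <= s' <= s1 -> t0 <= a -> b <= t1 -> cont_ver f s' a b.
  move=> tt aa bb x /andP[ax xb]; apply: (diff_rect_ver h tt).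
  by rewrite (le_trans aa ax) (le_trans xb bb).
have E : oint f s0 s1 t0 t1 = oint f s0 s t0 t + oint f s0 s t t1 +
   (oint f s s1 t0 t + oint f s s1 t t1).
  { rewrite (@oint_cat_hor _ s0 s s1)//.
  1: rewrite (@oint_cat_ver _ s0 s t0 t t1)//.
  1: rewrite (@oint_cat_ver _ s s1 t0 t t1)//.
  all: (apply: hor || apply: ver) => //.
  all: by rewrite ?lexx ?s01 ?t01 ?s0s ?ss1 ?t0t ?tt1. }
pose m := Num.max (Num.max `|oint f s0 s t0 t| `|oint f s0 s t t1|)
   (Num.max `|oint f s s1 t0 t| `|oint f s s1 t t1|).
have hm : `|oint f s0 s1 t0 t1| <= 4 * m.
  rewrite E; apply: le_trans (ler_normD _ _) _.
  apply: le_trans (lerD (ler_normD _ _) (ler_normD _ _)) _.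
  have m1 : `|oint f s0 s t0 t| <= m by rewrite /m !le_max lexx ?orbT.
  have m2 : `|oint f s0 s t t1| <= m by rewrite /m !le_max lexx ?orbT.
  have m3 : `|oint f s s1 t0 t| <= m by rewrite /m !le_max lexx ?orbT.
  have m4 : `|oint f s s1 t t1| <= m by rewrite /m !le_max lexx ?orbT.
  lra.
have [a [b [aE bE mE]]] : exists a b, [/\ a = s0 \/ a = s, b = t0 \/ b = t &
   m = `|oint f a (a + (s1 - s0) / 2) b (b + (t1 - t0) / 2)|].
  rewrite /m; case: leP => _; case: leP => _.
  - by exists s, t; rewrite s1E t1E; split; auto.
  - by exists s, t0; rewrite s1E -/t; split; auto.
  - by exists s0, t; rewrite t1E -/s; split; auto.
  - by exists s0, t0; rewrite -/s -/t; split; auto.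
exists a, b; rewrite -mE; split => //; first by case: aE => ->.
- by case: aE => ->; rewrite /s; lra.
- by case: bE => ->.
- by case: bE => ->; rewrite /t; lra.
Qed.

(** An affine function has integral 0, so the integral is controlled by the
    distance e from f to an affine function. *)
Lemma oint_small f s0 s1 t0 t1 p q (d : R[i]) (e : R) :
  s0 <= p <= s1 -> t0 <= q <= t1 -> diff_rect f s0 s1 t0 t1 -> 0 <= e ->
  (forall s t, s0 <= s <= s1 -> t0 <= t <= t1 ->
    normc (f (s +i* t) - f (p +i* q) - d * (s +i* t - p +i* q)) <= e) ->
  `|oint f s0 s1 t0 t1| <= 2 * e * (s1 - s0 + (t1 - t0)).
Proof.
move=> hp hq h e0 he.
have s01 : s0 <= s1 by case/andP: hp => /le_trans; apply.
have t01 : t0 <= t1 by case/andP: hq => /le_trans; apply.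
set k := complex.Re d.
have hA s : s0 <= s <= s1 ->
  `|complex.Im (f (s +i* t0)) - complex.Im (f (s +i* t1)) - k * (t0 - t1)| <= 2 * e.
  move=> ss.
  have t00 : t0 <= t0 <= t1 by rewrite lexx.
  have t11 : t0 <= t1 <= t1 by rewrite lexx andbT.
  have := le_trans (normIm_le _) (he _ _ ss t00).
  have := le_trans (normIm_le _) (he _ _ ss t11).
  rewrite /k; move: (f (s +i* t0)) (f (s +i* t1)) (f (p +i* q)) => [a b] [a' b'] [a'' b''].
  case: (d) => d1 d2 /=; rewrite !ler_norml => /andP[? ?] /andP[? ?].
  by apply/andP; split; lra.
have hB t : t0 <= t <= t1 ->
  `|complex.Re (f (s1 +i* t)) - complex.Re (f (s0 +i* t)) - k * (s1 - s0)| <= 2 * e.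
  move=> tt.
  have s00 : s0 <= s0 <= s1 by rewrite lexx.
  have s11 : s0 <= s1 <= s1 by rewrite lexx andbT.
  have := le_trans (normRe_le _) (he _ _ s00 tt).
  have := le_trans (normRe_le _) (he _ _ s11 tt).
  rewrite /k; move: (f (s1 +i* t)) (f (s0 +i* t)) (f (p +i* q)) => [a b] [a' b'] [a'' b''].
  case: (d) => d1 d2 /=; rewrite !ler_norml => /andP[? ?] /andP[? ?].
  by apply/andP; split; lra.
have cA : cont_seg (fun s => complex.Im (f (s +i* t0)) - complex.Im (f (s +i* t1))) s0 s1.
  by apply: cont_segB; apply: cont_segIm; apply: (diff_rect_hor h); rewrite lexx ?andbT.
have cB : cont_seg (fun t => complex.Re (f (s1 +i* t)) - complex.Re (f (s0 +i* t))) t0 t1.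
  by apply: cont_segB; apply: cont_segRe; apply: (diff_rect_ver h); rewrite lexx ?andbT.
have := @sint_ge _ _ _ _ (k * (t0 - t1) - 2 * e) s01 cA.
have := @sint_le _ _ _ _ (k * (t0 - t1) + 2 * e) s01 cA.
have := @sint_ge _ _ _ _ (k * (s1 - s0) - 2 * e) t01 cB.
have := @sint_le _ _ _ _ (k * (s1 - s0) + 2 * e) t01 cB.
rewrite /oint.
set I1 := sint _ s0 s1; set I2 := sint _ t0 t1.
move=> H1 H2 H3 H4.
have {}H1 : I2 <= (k * (s1 - s0) + 2 * e) * (t1 - t0).
  by apply: H1 => t /hB; rewrite ler_norml => /andP[? ?]; lra.
have {}H2 : (k * (s1 - s0) - 2 * e) * (t1 - t0) <= I2.
  by apply: H2 => t /hB; rewrite ler_norml => /andP[? ?]; lra.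
have {}H3 : I1 <= (k * (t0 - t1) + 2 * e) * (s1 - s0).
  by apply: H3 => t /hA; rewrite ler_norml => /andP[? ?]; lra.
have {}H4 : (k * (t0 - t1) - 2 * e) * (s1 - s0) <= I1.
  by apply: H4 => t /hA; rewrite ler_norml => /andP[? ?]; lra.
by rewrite ler_norml; apply/andP; split; lra.
Qed.

Lemma nested_segments (u l : nat -> R) : (forall n, 0 <= l n) ->
  (forall n, u n <= u n.+1) -> (forall n, u n.+1 + l n.+1 <= u n + l n) ->
  exists p, forall n, u n <= p <= u n + l n.
Proof.
move=> l0 hu hl.
have mu : {homo u : m n / (m <= n)%N >-> m <= n}.
  by apply: homo_leq => //; exact: le_trans.
have ml m n : (m <= n)%N -> u n + l n <= u m + l m.
  elim: n => [|n ih]; first by rewrite leqn0 => /eqP ->.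
  rewrite leq_eqVlt => /predU1P[->//|]; rewrite ltnS => /ih; exact: le_trans.
have key m n : u m <= u n + l n.
  have [mn|/ltnW nm] := leqP m n.
    by apply: le_trans (mu _ _ mn) _; rewrite lerDl.
  by apply: le_trans (ml _ _ nm); rewrite lerDl.
exists (sup (range u)) => n; apply/andP; split.
  apply: ub_le_sup; last by exists n.
  by exists (u 0%N + l 0%N) => _ [m _ <-].
by apply: ge_sup; [exists (u 0%N), 0%N|move=> _ [m _ <-]].
Qed.

(** Quartering the rectangle repeatedly produces nested rectangles shrinking to
    a point, on the n-th of which the integral is at least [4 ^- n] times the
    original one; differentiability at the point makes it smaller than that. *)
Lemma goursat f s0 s1 t0 t1 : s0 <= s1 -> t0 <= t1 -> diff_rect f s0 s1 t0 t1 ->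
  oint f s0 s1 t0 t1 = 0.
Proof.
move=> s01 t01 h; apply/eqP; rewrite -normr_le0; apply/ler_addgt0Pr => eta eta0; rewrite add0r.
pose a := s1 - s0; pose b := t1 - t0.
pose A n := a / 2 ^+ n; pose B n := b / 2 ^+ n.
pose I n s t := `|oint f s (s + A n) t (t + B n)|.
have a0 : 0 <= a by rewrite subr_ge0.
have b0 : 0 <= b by rewrite subr_ge0.
have A0 n : 0 <= A n by rewrite divr_ge0// exprn_ge0.
have B0 n : 0 <= B n by rewrite divr_ge0// exprn_ge0.
have AS n : A n.+1 = A n / 2 by rewrite /A exprS invfM mulrA mulrAC.
have BS n : B n.+1 = B n / 2 by rewrite /B exprS invfM mulrA mulrAC.
pose ok n s t := [/\ s0 <= s, s + A n <= s1, t0 <= t & t + B n <= t1].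
have okD n s t : ok n s t -> diff_rect f s (s + A n) t (t + B n).
  by case=> ? ? ? ?; exact: (diff_rectW _ _ _ _ h).
have step (x : nat * (R * R)) : exists y : R * R, ok x.1 x.2.1 x.2.2 ->
  [/\ ok x.1.+1 y.1 y.2, x.2.1 <= y.1, y.1 + A x.1.+1 <= x.2.1 + A x.1,
     x.2.2 <= y.2 /\ y.2 + B x.1.+1 <= x.2.2 + B x.1 &
     I x.1 x.2.1 x.2.2 <= 4 * I x.1.+1 y.1 y.2].
  case: x => n [s t] /=.
  have [okx|] := pselect (ok n s t); last by exists (0, 0).
  have eA : s + A n - s = A n by rewrite addrAC subrr add0r.
  have eB : t + B n - t = B n by rewrite addrAC subrr add0r.
  have := @oint_quarter f s (s + A n) t (t + B n); rewrite !lerDl.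
  move=> /(_ (A0 n) (B0 n) (okD _ _ _ okx)).
  rewrite eA eB -AS -BS => -[s' [t' [? ? ? ? ?]]].
  exists (s', t') => _; split => //=.
  by case: okx => ? ? ? ?; split; lra.
have [nx hnx] := choice step.
pose u := fix u n := if n is m.+1 then nx (m, u m) else (s0, t0).
have uok n : ok n (u n).1 (u n).2.
  elim: n => [|n ih]; last by have [] := hnx (n, u n) ih.
  by rewrite /ok /A /B !expr0 !divr1 /a /b /= !subrKC lexx !lexx.
have u1 n : (u n).1 <= (u n.+1).1 by have [] := hnx (n, u n) (uok n).
have u1' n : (u n.+1).1 + A n.+1 <= (u n).1 + A n.
  by have [] := hnx (n, u n) (uok n).
have u2 n : (u n).2 <= (u n.+1).2 by have [_ _ _ []] := hnx (n, u n) (uok n).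
have u2' n : (u n.+1).2 + B n.+1 <= (u n).2 + B n.
  by have [_ _ _ []] := hnx (n, u n) (uok n).
have uI n : I 0%N s0 t0 <= 4 ^+ n * I n (u n).1 (u n).2.
  elim: n => [|n ih]; first by rewrite expr0 mul1r.
  apply: le_trans ih _; rewrite exprSr -mulrA ler_pM2l ?exprn_gt0//.
  by have [] := hnx (n, u n) (uok n).
have I0 : I 0%N s0 t0 = `|oint f s0 s1 t0 t1|.
  by rewrite /I /A /B !expr0 !divr1 /a /b !subrKC.
have [p hp] := nested_segments A0 u1 u1'.
have [q hq] := nested_segments B0 u2 u2'.
have dpq : differentiable (f : C -> C) (p +i* q : C).
  apply: h.
    have := hp 0%N; rewrite /= /A expr0 divr1 /a subrKC; exact.
  have := hq 0%N; rewrite /= /B expr0 divr1 /b subrKC; exact.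
have [d hd] := (differentiable_normcP _ _).1 dpq.
pose K := a + b + 1.
have K0 : 0 < K by rewrite /K; lra.
(* the n-th rectangle has half-perimeter at most [K / 2 ^+ n], so its integral
   is at most [2 * e * (K / 2 ^+ n) ^+ 2] *)
pose e := eta / (2 * K ^+ 2).
have e0 : 0 < e by rewrite divr_gt0// mulr_gt0// exprn_gt0.
have [r r0 hr] := hd _ e0.
have [n hn] : exists n, K / 2 ^+ n < r.
  exists (Num.bound (K / r)).
  rewrite ltr_pdivrMr ?exprn_gt0// mulrC -ltr_pdivrMr//.
  exact: upper_nthrootP.
have tn0 : 0 < 2 ^+ n :> R by rewrite exprn_gt0.
have hAB : A n + B n <= K / 2 ^+ n.
  by rewrite /A /B -mulrDl ler_pM2r ?invr_gt0// /K; lra.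
have := @oint_small f (u n).1 ((u n).1 + A n) (u n).2 ((u n).2 + B n) p q d
   (e * (K / 2 ^+ n)) (hp n) (hq n) (okD _ _ _ (uok n)).
rewrite ![_ + _ - _]addrAC !subrr !add0r => /(_ _ _) H.
have {}H : I n (u n).1 (u n).2 <= 2 * (e * (K / 2 ^+ n)) * (A n + B n).
  apply: H; first by rewrite mulr_ge0// ?ltW// divr_gt0.
  move=> s t hs ht.
  have dist : normc (s +i* t - p +i* q) <= K / 2 ^+ n.
    apply: le_trans (normc_le_ReIm _) _; apply: le_trans hAB.
    move: hs ht (hp n) (hq n) => /= /andP[? ?] /andP[? ?] /andP[? ?] /andP[? ?].
    by apply: lerD; rewrite ler_norml; apply/andP; split; lra.
  apply: le_trans (hr _ (le_lt_trans dist hn)) _.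
  by rewrite ler_pM2l.
rewrite -I0; apply: le_trans (uI n) _.
apply: le_trans (ler_wpM2l _ H) _; first by rewrite exprn_ge0.
apply: (@le_trans _ _ (4 ^+ n * (2 * (e * (K / 2 ^+ n)) * (K / 2 ^+ n)))).
  rewrite ler_pM2l ?exprn_gt0// ler_wpM2l//.
  by apply: mulr_ge0 => //; apply: mulr_ge0; [exact: ltW|apply: divr_ge0; exact: ltW].
rewrite /e; have -> : 4 ^+ n = 2 ^+ n * 2 ^+ n :> R.
  by rewrite -exprMn -natrM.
rewrite le_eqVlt; apply/orP; left; apply/eqP.
field.
by rewrite !lt0r_neq0.
Qed.

End Goursat.

(** * A bound for the value at the centre of a disc *)

Section CauchyEstimate.
Variable R : realType.
Local Notation C := (Cpx R).
Implicit Types (f : R[i] -> R[i]) (s t : R).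

(** Complex differentiability on the square [[-L, L] x [-L, L]] without 0. *)
Definition diff_punctured_square f (L : R) := forall s t, `|s| <= L -> `|t| <= L ->
  s +i* t != 0 -> differentiable (f : C -> C) (s +i* t : C).

(** The integral does not depend on the size of the square: the difference of
    two concentric squares is cut into four rectangles avoiding 0. *)
Lemma oint_square f (l L : R) : 0 < l -> l <= L -> diff_punctured_square f L ->
  oint f (- L) L (- L) L = oint f (- l) l (- l) l.
Proof.
move=> l0 lL h.
have nz1 s t : s != 0 -> s +i* t != 0 by rewrite eq_complex /= => /negbTE ->.
have nz2 s t : t != 0 -> s +i* t != 0 by rewrite eq_complex /= andbC => /negbTE ->.
have hor t a b : t != 0 -> `|t| <= L -> - L <= a -> b <= L -> cont_hor f t a b.
  move=> tn0 tL aL bL s /andP[ss1 ss2]; apply: differentiable_continuous.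
  by apply: h => //; [rewrite ler_norml (le_trans aL)//= (le_trans ss2)|exact: nz2].
have ver s a b : s != 0 -> `|s| <= L -> - L <= a -> b <= L -> cont_ver f s a b.
  move=> sn0 sL aL bL t /andP[t1 t2]; apply: differentiable_continuous.
  by apply: h => //; [rewrite ler_norml (le_trans aL)//= (le_trans t2)|exact: nz1].
have L0 : 0 < L by exact: lt_le_trans lL.
have nL : L != 0 by rewrite lt0r_neq0.
have nl : l != 0 by rewrite lt0r_neq0.
have nNL : - L != 0 by rewrite oppr_eq0.
have nNl : - l != 0 by rewrite oppr_eq0.
have aL : `|L| <= L by rewrite ger0_norm// ltW.
have aNL : `|- L| <= L by rewrite normrN.
have al : `|l| <= L by rewrite ger0_norm// ltW.
have aNl : `|- l| <= L by rewrite normrN.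
have LNl : - L <= - l by rewrite lerN2.
have NlL : - l <= L by lra.
have Nll : - l <= l by lra.
have NLl : - L <= l by lra.
have NLL : - L <= L by lra.
rewrite (@oint_cat_hor _ _ (- L) (- l) L)//; try by [apply: hor|apply: ver].
rewrite (@oint_cat_hor _ _ (- l) l L)//; try by [apply: hor|apply: ver].
rewrite (@oint_cat_ver _ _ (- l) l (- L) (- l) L)//; try by [apply: hor|apply: ver].
rewrite (@oint_cat_ver _ _ (- l) l (- l) l L)//; try by [apply: hor|apply: ver].
rewrite (@goursat _ f (- L) (- l) (- L) L)//; last first.
  move=> s t /andP[s1 s2] /andP[t1 t2]; apply: h.
  - by rewrite ler_norml s1 (le_trans s2).
  - by rewrite ler_norml t1.
  - by apply: nz1; rewrite lt_eqF// (le_lt_trans s2)// oppr_lt0.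
rewrite (@goursat _ f l L (- L) L)//; last first.
  move=> s t /andP[s1 s2] /andP[t1 t2]; apply: h.
  - by rewrite ler_norml s2 (le_trans NLl).
  - by rewrite ler_norml t1.
  - by apply: nz1; rewrite gt_eqF// (lt_le_trans l0).
rewrite (@goursat _ f (- l) l (- L) (- l))//; last first.
  move=> s t /andP[s1 s2] /andP[t1 t2]; apply: h.
  - by rewrite ler_norml (le_trans LNl)//= (le_trans s2).
  - by rewrite ler_norml t1 (le_trans t2).
  - by apply: nz2; rewrite lt_eqF// (le_lt_trans t2)// oppr_lt0.
rewrite (@goursat _ f (- l) l l L)//; last first.
  move=> s t /andP[s1 s2] /andP[t1 t2]; apply: h.
  - by rewrite ler_norml (le_trans LNl)//= (le_trans s2).
  - by rewrite ler_norml t2 (le_trans NLl).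
  - by apply: nz2; rewrite gt_eqF// (lt_le_trans l0).
by rewrite !add0r !addr0.
Qed.

Lemma normc_geRe s t : `|s| <= normc (s +i* t).
Proof. exact: (normRe_le (s +i* t)). Qed.
Lemma normc_geIm s t : `|t| <= normc (s +i* t).
Proof. exact: (normIm_le (s +i* t)). Qed.

Lemma ImD (x y : R[i]) : complex.Im (x + y) = complex.Im x + complex.Im y.
Proof. by case: x; case: y. Qed.
Lemma ReD (x y : R[i]) : complex.Re (x + y) = complex.Re x + complex.Re y.
Proof. by case: x; case: y. Qed.

Lemma Im_real_div (m s t : R) : complex.Im (m%:C / (s +i* t)) = - (m * t) / (s ^+ 2 + t ^+ 2).
Proof. by rewrite /=; ring. Qed.
Lemma Re_real_div (m s t : R) : complex.Re (m%:C / (s +i* t)) = (m * s) / (s ^+ 2 + t ^+ 2).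
Proof. by rewrite /=; ring. Qed.

(** On a small square about 0 the integral of [f z / z] is about [f 0] times
    the integral of [1 / z], whose imaginary part is at least 4. *)
Lemma oint_small_square f (l m e : R) : 0 < l -> 0 <= m ->
  (forall s t, `|s| <= l -> `|t| <= l -> normc (f (s +i* t) - m%:C) <= e) ->
  diff_punctured_square (fun z => f z / z) l ->
  4 * m - 8 * e <= oint (fun z => f z / z) (- l) l (- l) l.
Proof.
move=> l0 m0 he hd.
have Nll : - l <= l by lra.
have nz1 s t : s != 0 -> s +i* t != 0 by rewrite eq_complex /= => /negbTE ->.
have nz2 s t : t != 0 -> s +i* t != 0 by rewrite eq_complex /= andbC => /negbTE ->.
have nl : l != 0 by rewrite lt0r_neq0.
have nNl : - l != 0 by rewrite oppr_eq0.
have al : `|l| = l by rewrite ger0_norm// ltW.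
have aNl : `|- l| = l by rewrite normrN.
have hor t : `|t| = l -> cont_hor (fun z => f z / z) t (- l) l.
  move=> tl s; rewrite -ler_norml => sl; apply: differentiable_continuous.
  by apply: hd; rewrite ?tl//; apply: nz2; rewrite -normr_gt0 tl.
have ver s : `|s| = l -> cont_ver (fun z => f z / z) s (- l) l.
  move=> sl t; rewrite -ler_norml => tl; apply: differentiable_continuous.
  by apply: hd; rewrite ?sl//; apply: nz1; rewrite -normr_gt0 sl.
have err s t : `|s| <= l -> `|t| <= l -> l <= normc (s +i* t) ->
    normc ((f (s +i* t) - m%:C) / (s +i* t)) <= e / l.
  move=> sl tl ln; rewrite normcM normcV ler_pM ?invr_ge0 ?normc_ge0//.
    exact: he.
  by rewrite lef_pV2// posrE// (lt_le_trans l0).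
have split s t : f (s +i* t) / (s +i* t) = m%:C / (s +i* t) + (f (s +i* t) - m%:C) / (s +i* t).
  by rewrite -mulrDl addrC subrK.
have ker s : `|s| <= l -> m / (2 * l) <= m * l / (s ^+ 2 + l ^+ 2).
  move=> sl; rewrite ler_pdivrMr ?mulr_gt0// mulrAC ler_pdivlMr; last first.
    by rewrite ltr_wpDl ?sqr_ge0// exprn_gt0.
  rewrite -mulrA; apply: ler_wpM2l => //.
  move: sl; rewrite ler_norml => /andP[s1 s2].
  have : 0 <= (l - s) * (l + s) by rewrite mulr_ge0//; lra.
  by rewrite !expr2; lra.
have lexx_of (x : R) : `|x| = l -> `|x| <= l by move=> ->.
have geIm s t : `|t| = l -> l <= normc (s +i* t) by move=> <-; exact: normc_geIm.
have geRe t s : `|s| = l -> l <= normc (s +i* t) by move=> <-; exact: normc_geRe.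
have A0 s : `|s| <= l -> m / l - 2 * (e / l) <=
    complex.Im (f (s +i* - l) / (s +i* - l)) - complex.Im (f (s +i* l) / (s +i* l)).
  move=> sl; rewrite !split !ImD.
  have := le_trans (normIm_le _) (err s (- l) sl (lexx_of _ aNl) (geIm s _ aNl)).
  have := le_trans (normIm_le _) (err s l sl (lexx_of _ al) (geIm s _ al)).
  rewrite !ler_norml => /andP[_ h1] /andP[h2 _].
  rewrite !Im_real_div.
  have := ker _ sl; rewrite sqrrN mulrN opprK.
  have -> : m / (2 * l) = m / l / 2 by field.
  move: h1 h2; rewrite !mulNr.
  lra.
have B0 t : `|t| <= l -> m / l - 2 * (e / l) <=
    complex.Re (f (l +i* t) / (l +i* t)) - complex.Re (f (- l +i* t) / (- l +i* t)).
  move=> tl; rewrite !split !ReD.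
  have := le_trans (normRe_le _) (err l t (lexx_of _ al) tl (geRe t _ al)).
  have := le_trans (normRe_le _) (err (- l) t (lexx_of _ aNl) tl (geRe t _ aNl)).
  rewrite !ler_norml => /andP[_ h1] /andP[h2 _].
  rewrite !Re_real_div.
  have := ker _ tl; rewrite sqrrN mulrN addrC.
  have -> : m / (2 * l) = m / l / 2 by field.
  move: h1 h2; rewrite !mulNr.
  lra.
have cA := cont_segB (cont_segIm (hor _ aNl)) (cont_segIm (hor _ al)).
have cB := cont_segB (cont_segRe (ver _ al)) (cont_segRe (ver _ aNl)).
have hA := @sint_ge _ _ _ _ (m / l - 2 * (e / l)) Nll cA.
have hB := @sint_ge _ _ _ _ (m / l - 2 * (e / l)) Nll cB.
rewrite /oint.
have -> : 4 * m - 8 * e = (m / l - 2 * (e / l)) * (l - - l) + (m / l - 2 * (e / l)) * (l - - l).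
  by field.
by apply: lerD; [apply: hA|apply: hB] => x; rewrite -ler_norml; [exact: A0|exact: B0].
Qed.

Lemma oint_square_le f (L M : R) : 0 < L ->
  (forall s t, Num.max `|s| `|t| = L -> normc (f (s +i* t)) <= M) ->
  diff_punctured_square (fun z => f z / z) L ->
  oint (fun z => f z / z) (- L) L (- L) L <= 8 * M.
Proof.
move=> L0 hM hd.
have Nll : - L <= L by lra.
have nz1 s t : s != 0 -> s +i* t != 0 by rewrite eq_complex /= => /negbTE ->.
have nz2 s t : t != 0 -> s +i* t != 0 by rewrite eq_complex /= andbC => /negbTE ->.
have al : `|L| = L by rewrite ger0_norm// ltW.
have aNl : `|- L| = L by rewrite normrN.
have hor t : `|t| = L -> cont_hor (fun z => f z / z) t (- L) L.
  move=> tl s; rewrite -ler_norml => sl; apply: differentiable_continuous.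
  by apply: hd; rewrite ?tl//; apply: nz2; rewrite -normr_gt0 tl.
have ver s : `|s| = L -> cont_ver (fun z => f z / z) s (- L) L.
  move=> sl t; rewrite -ler_norml => tl; apply: differentiable_continuous.
  by apply: hd; rewrite ?sl//; apply: nz1; rewrite -normr_gt0 sl.
have est s t : Num.max `|s| `|t| = L -> normc (f (s +i* t) / (s +i* t)) <= M / L.
  move=> st; rewrite normcM normcV ler_pM ?invr_ge0 ?normc_ge0//; first exact: hM.
  have Ln : L <= normc (s +i* t) by rewrite -st ge_max normc_geRe normc_geIm.
  by rewrite lef_pV2// posrE// (lt_le_trans L0).
have cA := cont_segB (cont_segIm (hor _ aNl)) (cont_segIm (hor _ al)).
have cB := cont_segB (cont_segRe (ver _ al)) (cont_segRe (ver _ aNl)).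
have hA := @sint_le _ _ _ _ (2 * (M / L)) Nll cA.
have hB := @sint_le _ _ _ _ (2 * (M / L)) Nll cB.
rewrite /oint.
have -> : 8 * M = (2 * (M / L)) * (L - - L) + (2 * (M / L)) * (L - - L).
  by field; rewrite lt0r_neq0.
apply: lerD; [apply: hA|apply: hB] => x; rewrite -ler_norml => xL.
  have := le_trans (normIm_le _) (est x (- L) _).
  rewrite aNl; move/max_r : (xL) => -> /(_ erefl).
  have := le_trans (normIm_le _) (est x L _).
  rewrite al; move/max_r : (xL) => -> /(_ erefl).
  by rewrite !ler_norml => /andP[? ?] /andP[? ?]; lra.
have := le_trans (normRe_le _) (est L x _).
rewrite al; move/max_l : (xL) => -> /(_ erefl).
have := le_trans (normRe_le _) (est (- L) x _).
rewrite aNl; move/max_l : (xL) => -> /(_ erefl).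
by rewrite !ler_norml => /andP[? ?] /andP[? ?]; lra.
Qed.

Lemma differentiableM_C (f g : R[i] -> R[i]) (z : R[i]) :
  differentiable (f : C -> C) (z : C) -> differentiable (g : C -> C) (z : C) ->
  differentiable (fun z : C => f z * g z : C) (z : C).
Proof. exact: differentiableM. Qed.

Lemma differentiableV_C (f : R[i] -> R[i]) (z : R[i]) :
  differentiable (f : C -> C) (z : C) -> f z != 0 ->
  differentiable (fun z : C => (f z)^-1 : C) (z : C).
Proof. exact: differentiableV. Qed.

Lemma differentiable_comp_K (K : numFieldType) (U V W : normedModType K)
  (g : U -> V) (f : V -> W) (z : U) : differentiable g z -> differentiable f (g z) ->
  differentiable (fun z => f (g z)) z.
Proof. exact: differentiable_comp. Qed.

Lemma differentiable_comp_C (f g : R[i] -> R[i]) (z : R[i]) :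
  differentiable (g : C -> C) (z : C) -> differentiable (f : C -> C) (g z : C) ->
  differentiable (fun z : C => f (g z) : C) (z : C).
Proof. exact: (@differentiable_comp_K R[i] C C C g f z). Qed.

Lemma differentiable_shift_C (w z : R[i]) : differentiable (fun z : C => z + w : C) (z : C).
Proof. by apply: differentiableD; [exact: ex_diff|exact: differentiable_cst]. Qed.

(** A crude mean value estimate: the value at the centre of a disc is at most
    twice the supremum over an annulus. *)
Lemma center_le2 f (w : R[i]) (r M : R) : 0 < r ->
  (forall z, normc (z - w) < 3 * r -> differentiable (f : C -> C) (z : C)) ->
  (forall z, r < normc (z - w) < 3 * r -> normc (f z) <= M) ->
  normc (f w) <= 2 * M.
Proof.
move=> r0 hd hM.
have [->|fw0] := eqVneq (f w) 0.
  rewrite normc0 mulr_ge0//; apply: le_trans (hM (w + (2 * r)%:C) _); rewrite ?normc_ge0//.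
  by rewrite addrAC subrr add0r normc_real ger0_norm; lra.
(* a rotation u makes the value at w a nonnegative real *)
pose m := normc (f w); pose u := m%:C / f w.
have m0 : 0 < m by rewrite normc_gt0.
have nu : normc u = 1.
  by rewrite normcM normcV normc_real ger0_norm ?(ltW m0)// divff// lt0r_neq0.
pose g z := u * f (z + w).
(* the boundary of the square of half-side 3r/2 lies in the annulus, as
   sqrt 2 * 3/2 < 3 *)
pose L := 3 / 2 * r.
have L0 : 0 < L by rewrite /L; lra.
have nL s t : `|s| <= L -> `|t| <= L -> normc (s +i* t) < 3 * r.
  move=> sL tL.
  have : normc (s +i* t) ^+ 2 <= (3/4 * 3 * r) ^+ 2.
    rewrite /= sqr_sqrtr ?addr_ge0 ?sqr_ge0//.
    move: sL tL; rewrite !ler_norml => /andP[s1 s2] /andP[t1 t2].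
    have : 0 <= (L - s) * (L + s) by rewrite mulr_ge0//; lra.
    have : 0 <= (L - t) * (L + t) by rewrite mulr_ge0//; lra.
    by rewrite /L !expr2; nra.
  rewrite ler_sqr ?nnegrE ?normc_ge0//; last by lra.
  lra.
have gd s t : `|s| <= L -> `|t| <= L -> differentiable (g : C -> C) (s +i* t : C).
  move=> sL tL; rewrite /g.
  apply: differentiableM_C; first exact: differentiable_cst.
  apply: (@differentiable_comp_C f (fun z => z + w)); first exact: differentiable_shift_C.
  by apply: hd; rewrite addrK; exact: nL.
have hdq : diff_punctured_square (fun z => g z / z) L.
  move=> s t sL tL st0; apply: differentiableM_C; first exact: gd.
  by apply: differentiableV_C => //; exact: ex_diff.
have gM s t : Num.max `|s| `|t| = L -> normc (g (s +i* t)) <= M.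
  move=> st; rewrite normcM nu mul1r; apply: hM; rewrite addrK.
  have sL : `|s| <= L by rewrite -st le_max lexx.
  have tL : `|t| <= L by rewrite -st le_max lexx orbT.
  rewrite (nL _ _ sL tL) andbT.
  have : L <= normc (s +i* t) by rewrite -st ge_max normc_geRe normc_geIm.
  by apply: lt_le_trans; rewrite /L; lra.
have g0 : g 0 = m%:C by rewrite /g add0r /u mulfVK.
have up := oint_square_le L0 gM hdq.
suff : forall e : R, 0 < e -> m <= 2 * M + 2 * e.
  move=> H; apply/ler_addgt0Pr => e e0.
  have e2 : 0 < e / 2 by rewrite divr_gt0.
  by have := H _ e2; rewrite -/m; lra.
move=> e e0.
have : {for (0 : C), continuous (g : C -> C)}.
  apply: differentiable_continuous.
  by have := gd 0 0; rewrite normr0; apply; exact: ltW.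
move=> /continuous_normcP /(_ _ e0)[d d0 hd0].
pose l := Num.min L (d / 4).
have l0 : 0 < l by rewrite lt_min L0 divr_gt0.
have lL : l <= L by rewrite ge_min lexx.
have ld : l <= d / 4 by rewrite ge_min lexx orbT.
have hdl : diff_punctured_square (fun z => g z / z) l.
  by move=> s t sl tl; apply: hdq; exact: le_trans lL.
have small s t : `|s| <= l -> `|t| <= l -> normc (g (s +i* t) - m%:C) <= e.
  move=> sl tl; rewrite -g0 ltW//; apply: hd0; rewrite subr0.
  apply: le_lt_trans (normc_le_ReIm _) _ => /=; lra.
have := oint_small_square l0 (ltW m0) small hdl.
rewrite -(oint_square l0 lL hdq) => /le_trans /(_ up).
lra.
Qed.

End CauchyEstimate.

(** * The maximum principle *)

Section MaximumPrinciple.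
Variable R : realType.
Local Notation C := (Cpx R).
Implicit Types (f g : R[i] -> R[i]) (S : seq R[i]) (z w : R[i]).

(** Constants independent of N disappear when N-th powers are compared for
    every N. *)
Lemma le_of_pow (a b k c : R) : 0 < k -> 0 <= b -> 0 <= a ->
  (forall N, a ^+ N * k <= b ^+ N * c) -> a <= b.
Proof.
move=> k0 b0 a0 h; rewrite leNgt; apply/negP => ba.
have c0 : 0 <= c by have := h 0%N; rewrite !expr0 !mul1r; apply: le_trans; exact: ltW.
pose b' := (a + b) / 2.
have b'0 : 0 < b' by rewrite /b'; lra.
pose x := a / b' - 1.
have x0 : 0 < x by rewrite subr_gt0 ltr_pdivlMr// mul1r /b'; lra.
have h' N : (1 + x) ^+ N * k <= c.
  rewrite /x addrC subrK expr_div_n mulrAC ler_pdivrMr ?exprn_gt0//.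
  apply: le_trans (h N) _; rewrite mulrC ler_wpM2l//.
  by apply: lerXn2r; rewrite ?nnegrE// /b'; lra.
have bern N : 1 + N%:R * x <= (1 + x) ^+ N.
  elim: N => [|N ih]; first by rewrite mul0r addr0 expr0.
  rewrite exprS; apply: le_trans (ler_wpM2l _ ih); last by lra.
  have : 0 <= N%:R * (x * x) :> R by rewrite mulr_ge0// mulr_ge0// ltW.
  by rewrite -natr1; lra.
have [N hN] : exists N : nat, c / (k * x) < N%:R.
  exists (Num.bound (c / (k * x))); apply: archi_boundP.
  by rewrite divr_ge0// mulr_ge0 ?ltW.
move: hN; rewrite ltr_pdivrMr ?mulr_gt0// => hN.
have := h' N; apply/negP; rewrite -ltNge.
apply: lt_le_trans (_ : (1 + N%:R * x) * k <= _); last by rewrite ler_pM2r.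
lra.
Qed.

Lemma eq_continuous_C f g z : f =1 g ->
  {for (z : C), continuous (f : C -> C)} -> {for (z : C), continuous (g : C -> C)}.
Proof. by move/funext => ->. Qed.

Lemma eq_differentiable_C f g z : f =1 g ->
  differentiable (f : C -> C) (z : C) -> differentiable (g : C -> C) (z : C).
Proof. by move/funext => ->. Qed.

(** A factor vanishing at p turns continuity at p into differentiability. *)
Lemma differentiable_mul_sub g p : {for (p : C), continuous (g : C -> C)} ->
  differentiable (fun z : C => (z - p : R[i]) * g z : C) (p : C).
Proof.
move=> /continuous_normcP h; apply/(differentiable_normcP (fun z => (z - p) * g z)).
exists (g p) => e e0; have [r r0 hr] := h _ e0; exists r => // z zr.
rewrite subrr mul0r subr0 mulrC -mulrBl normcM ler_wpM2r ?normc_ge0//.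
by rewrite ltW// hr.
Qed.

Lemma differentiableX_C f z n : differentiable (f : C -> C) (z : C) ->
  differentiable (fun z : C => f z ^+ n : C) (z : C).
Proof.
move=> h; elim: n => [|n ih]; first exact: differentiable_cst.
under eq_fun do rewrite exprS.
exact: differentiableM_C.
Qed.

Lemma continuousM_C f g z : {for (z : C), continuous (f : C -> C)} ->
  {for (z : C), continuous (g : C -> C)} ->
  {for (z : C), continuous (fun z : C => f z * g z : C)}.
Proof. exact: (@continuousM R[i] C). Qed.

Lemma continuousB_C f g z : {for (z : C), continuous (f : C -> C)} ->
  {for (z : C), continuous (g : C -> C)} ->
  {for (z : C), continuous (fun z : C => f z - g z : C)}.
Proof. exact: (@continuousB R[i] C C). Qed.

Lemma differentiableB_C f g z : differentiable (f : C -> C) (z : C) ->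
  differentiable (g : C -> C) (z : C) -> differentiable (fun z : C => f z - g z : C) (z : C).
Proof. exact: (@differentiableB R[i] C C). Qed.

Lemma continuousX_C f z n : {for (z : C), continuous (f : C -> C)} ->
  {for (z : C), continuous (fun z : C => f z ^+ n : C)}.
Proof.
move=> h; elim: n => [|n ih]; first exact: cst_continuous.
apply: (@eq_continuous_C (fun z => f z * f z ^+ n)); last exact: continuousM_C.
by move=> x; rewrite exprS.
Qed.

Lemma differentiable_prod_sub S z :
  differentiable (fun z : C => \prod_(p <- S) (z - p : R[i]) : C) (z : C).
Proof.
elim: S => [|p S ih].
  under eq_fun do rewrite big_nil.
  exact: differentiable_cst.
under eq_fun do rewrite big_cons.
apply: differentiableM_C => //; exact: differentiable_shift_C.
Qed.

(** Maximum principle on a disc, with finitely many exceptional points where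
    only continuity is assumed. The product of [f ^+ N] with the polynomial
    vanishing at the exceptional points is differentiable everywhere, and the
    factors other than [f ^+ N] disappear as [N] tends to infinity. *)
Lemma max_principle f S w (r M : R) : 0 < r -> 0 <= M -> w \notin S ->
  (forall z, normc (z - w) < 3 * r -> {for (z : C), continuous (f : C -> C)}) ->
  (forall z, normc (z - w) < 3 * r -> z \notin S -> differentiable (f : C -> C) (z : C)) ->
  (forall z, r < normc (z - w) < 3 * r -> z \notin S -> normc (f z) <= M) ->
  normc (f w) <= M.
Proof.
move=> r0 M0 wS hc hd hM.
pose P z : R[i] := \prod_(p <- S) (z - p).
pose c0 : R := \prod_(p <- S) (3 * r + normc (w - p)).
have Pw : 0 < normc (P w).
  rewrite normc_gt0 /P prodf_seq_neq0; apply/allP => p pS.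
  by rewrite /= subr_eq0; apply: contraNneq wS => ->.
have Pc z : normc (z - w) < 3 * r -> normc (P z) <= c0.
  move=> zw; rewrite /P /c0.
  elim/big_ind2 : _ => [|x1 x2 y1 y2 h1 h2|p _]; first by rewrite normc1.
    by rewrite normcM ler_pM ?normc_ge0.
  rewrite -(subrK w z) -addrA; apply: le_trans (le_normcD _ _) _.
  by rewrite lerD2r ltW.
apply: (@le_of_pow _ _ (normc (P w)) (2 * c0)) => //; first exact: normc_ge0.
move=> N; rewrite mulrCA -normcX -normcM.
apply: (@center_le2 _ (fun z => f z ^+ N * P z) w r (M ^+ N * c0)) => // z zr.
  have [zS|zS] := boolP (z \in S); last first.
    apply: differentiableM_C; last exact: differentiable_prod_sub.
    exact/differentiableX_C/hd.
  apply: (@eq_differentiable_C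
     (fun x => (x - z) * (f x ^+ N * \prod_(p <- rem z S) (x - p)))).
    by move=> x; rewrite /P (big_rem z zS); exact: (@mulrCA R[i]).
  apply: differentiable_mul_sub; apply: continuousM_C; first exact/continuousX_C/hc.
  exact/differentiable_continuous/differentiable_prod_sub.
case/andP: (zr) => _ zr2; rewrite normcM normcX.
have [zS|zS] := boolP (z \in S).
  rewrite /P (big_rem z)//= subrr mul0r normc0 mulr0 mulr_ge0 ?exprn_ge0//.
  by apply: le_trans (Pc _ zr2); exact: normc_ge0.
apply: ler_pM; rewrite ?exprn_ge0 ?normc_ge0//; last exact: Pc.
by apply: lerXn2r; rewrite ?nnegrE ?normc_ge0//; exact: hM.
Qed.

End MaximumPrinciple.

(** * Divided differences and the identity theorem *)

Section DividedDifferences.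
Variable R : realType.
Local Notation C := (Cpx R).
Implicit Types (f g q : R[i] -> R[i]) (S : seq R[i]) (z w c : R[i]).

(** f is continuous on the disc of radius r about c, and complex differentiable
    there except possibly at the points of the finite sequence S. *)
Definition holo_off f S c (r : R) :=
  (forall z, normc (z - c) < r -> {for (z : C), continuous (f : C -> C)}) /\
  (forall z, normc (z - c) < r -> z \notin S -> differentiable (f : C -> C) (z : C)).

Lemma near_eq_continuous_C f g z (r : R) : 0 < r ->
  (forall z', normc (z' - z) < r -> f z' = g z') ->
  {for (z : C), continuous (f : C -> C)} -> {for (z : C), continuous (g : C -> C)}.
Proof.
move=> r0 fg /continuous_normcP hf; apply/continuous_normcP => e /hf[d d0 hd].
exists (Num.min d r); first by rewrite lt_min d0.
move=> z'; rewrite lt_min => /andP[z'd z'r]; rewrite -!fg//; first exact: hd.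
by rewrite subrr normc0.
Qed.

Lemma near_eq_differentiable_C f g z (r : R) : 0 < r ->
  (forall z', normc (z' - z) < r -> f z' = g z') ->
  differentiable (f : C -> C) (z : C) -> differentiable (g : C -> C) (z : C).
Proof.
move=> r0 fg /differentiable_normcP[D hf]; apply/differentiable_normcP.
exists D => e /hf[d d0 hd].
exists (Num.min d r); first by rewrite lt_min d0.
move=> z'; rewrite lt_min => /andP[z'd z'r]; rewrite -!fg//; first exact: hd.
by rewrite subrr normc0.
Qed.

(** A bound on an annulus whose outer radius is 7 times the inner one extends to
    the whole disc.  A point z with |z - c| <= d is the centre of the annulus
    2d < |z' - z| < 6d, contained in d < |z' - c| < 7d. *)
Lemma max_disc f S c (d M : R) : 0 < d -> 0 <= M -> holo_off f S c (7 * d) ->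
  (forall z, d < normc (z - c) < 7 * d -> z \notin S -> normc (f z) <= M) ->
  forall z, normc (z - c) < 7 * d -> z \notin S -> normc (f z) <= M.
Proof.
move=> d0 M0 [hc hd] hM z zc zS.
have [dz|zd] := ltP d (normc (z - c)); first by apply: hM; rewrite ?dz.
have far z' : normc (z' - z) < 6 * d -> normc (z' - c) < 7 * d.
  move=> z'z; rewrite -(subrK z z') -addrA; apply: le_lt_trans (le_normcD _ _) _.
  lra.
apply: (@max_principle _ f S z (2 * d)) => //; first by lra.
- by move=> z' z'z; apply: hc; apply: far; lra.
- by move=> z' z'z; apply: hd; apply: far; lra.
move=> z' /andP[z'1 z'2]; apply: hM; rewrite far ?andbT; last by lra.
have := le_normcD (z' - c) (c - z); rewrite addrA subrK (normcBC c z).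
lra.
Qed.

(** The divided difference of f at w, completed by the derivative at w, is again
    continuous, w being a new exceptional point; the maximum principle bounds
    it. *)
Lemma dslope f S c (d B : R) w : 0 < d -> 0 <= B -> holo_off f S c (7 * d) ->
  w \notin S -> normc (w - c) < d / 2 ->
  (forall z, d < normc (z - c) < 7 * d -> z \notin S -> normc (f z - f w) <= B) ->
  exists q, [/\ holo_off q (w :: S) c (7 * d),
    forall z, z != w -> q z = (f z - f w) / (z - w) &
    forall z, normc (z - c) < 7 * d -> z \notin w :: S -> normc (q z) <= 2 * B / d].
Proof.
move=> d0 B0 [hc hd] wS wc hB.
have w7 : normc (w - c) < 7 * d by lra.
have [D hD] := (differentiable_normcP _ _).1 (hd _ w7 wS).
pose q z := if z == w then D else (f z - f w) / (z - w).
have qE z : z != w -> q z = (f z - f w) / (z - w) by rewrite /q => /negbTE ->.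
have qnear z : z != w -> exists2 r : R, 0 < r &
    forall z', normc (z' - z) < r -> (f z' - f w) / (z' - w) = q z'.
  move=> zw; exists (normc (z - w)); first by rewrite normc_gt0 subr_eq0.
  by move=> z' z'z; rewrite qE//; apply: contraTneq z'z => ->; rewrite normcBC ltxx.
have cq z : z != w -> {for (z : C), continuous (f : C -> C)} ->
    {for (z : C), continuous (q : C -> C)}.
  move=> zw fz; have [r r0 hr] := qnear _ zw; apply: (near_eq_continuous_C r0 hr).
  apply: continuousM_C.
    exact: continuousB_C (@cst_continuous _ _ _ _).
  apply: differentiable_continuous; apply: differentiableV_C; last by rewrite subr_eq0.
  exact: differentiable_shift_C.
have hq : holo_off q (w :: S) c (7 * d).
  split=> [z zc|z zc].
    have [->|zw] := eqVneq z w; last by apply: cq => //; exact: hc.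
    apply/continuous_normcP => e e0; have e2 : 0 < e / 2 by rewrite divr_gt0.
    have [r r0 hr] := hD _ e2.
    exists r => // z' z'w; rewrite {2}/q eqxx.
    have [->|z'nw] := eqVneq z' w; first by rewrite /q eqxx subrr normc0.
    rewrite qE//.
    have n0 : z' - w != 0 by rewrite subr_eq0.
    have -> : (f z' - f w) / (z' - w) - D = (f z' - f w - D * (z' - w)) / (z' - w).
      by rewrite [RHS]mulrBl mulfK.
    rewrite normcM normcV ltr_pdivrMr ?normc_gt0//.
    apply: le_lt_trans (hr _ z'w) _; rewrite ltr_pM2r ?normc_gt0//; lra.
  rewrite inE negb_or => /andP[zw zS].
  have [r r0 hr] := qnear _ zw; apply: (near_eq_differentiable_C r0 hr).
  apply: differentiableM_C.
    exact: differentiableB_C (hd _ zc zS) (differentiable_cst _ _).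
  apply: differentiableV_C; last by rewrite subr_eq0.
  exact: differentiable_shift_C.
exists q; split => //.
have BB : 0 <= 2 * B / d by apply: divr_ge0; [exact: mulr_ge0|exact: ltW].
apply: max_disc => //.
move=> z zc; rewrite inE negb_or => /andP[zw zS]; rewrite qE// normcM normcV.
have := hB z zc zS; move: zc => /andP[zc1 zc2] hBz.
have : d / 2 <= normc (z - w).
  have := le_normcD (z - w) (w - c); rewrite addrA subrK; lra.
move=> dzw; rewrite ler_pdivrMr; last by apply: lt_le_trans dzw; lra.
apply: le_trans hBz _.
rewrite [leLHS](_ : B = 2 * B / d * (d / 2)); last by field; rewrite lt0r_neq0.
exact: ler_wpM2l.
Qed.

(** Each zero of f near c gains a factor 1/2 in the bound of f near c. *)
Lemma zeros_bound c (d : R) (ws : seq R[i]) : 0 < d -> forall f S (M : R), uniq ws ->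
  (forall w, w \in ws -> [/\ w \notin S, normc (w - c) < d / 8 & f w = 0]) ->
  holo_off f S c (7 * d) -> 0 <= M ->
  (forall z, normc (z - c) < 7 * d -> z \notin S -> normc (f z) <= M) ->
  forall z, normc (z - c) < d / 8 -> z \notin S -> normc (f z) <= M / 2 ^+ (size ws).
Proof.
move=> d0; elim: ws => [|w ws ih] f S M.
  by move=> _ _ _ M0 hM z zc zS; rewrite expr0 divr1; apply: hM => //; lra.
move=> /= /andP[wws uws] hws hf M0 hM z zc zS.
have [wS wc fw] := hws w (mem_head _ _).
have wc2 : normc (w - c) < d / 2 by lra.
have hB z' : d < normc (z' - c) < 7 * d -> z' \notin S -> normc (f z' - f w) <= M.
  by move=> /andP[_ ?] ?; rewrite fw subr0; exact: hM.
have [q [hq qE qB]] := dslope d0 M0 hf wS wc2 hB.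
have [->|zw] := eqVneq z w.
  by rewrite fw normc0 divr_ge0// exprn_ge0.
have n0 : z - w != 0 by rewrite subr_eq0.
have -> : f z = q z * (z - w) by rewrite qE// fw subr0 divfK.
have hqz : normc (q z) <= 2 * M / d / 2 ^+ size ws.
  apply: (ih q (w :: S)) => //.
  - move=> w' w'ws; have [|w'S w'c fw'] := hws w'; first by rewrite inE w'ws orbT.
    have w'w : w' != w by apply: contraNneq wws => <-.
    by rewrite inE negb_or w'w w'S qE// fw fw' subrr mul0r.
  - by rewrite divr_ge0 ?(ltW d0)// mulr_ge0.
  - by rewrite inE negb_or zw zS.
rewrite normcM exprS.
have zwd : normc (z - w) <= d / 4.
  have := le_normcD (z - c) (c - w); rewrite addrA subrK (normcBC c w); lra.
apply: le_trans (ler_pM _ _ hqz zwd) _; rewrite ?normc_ge0//.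
rewrite le_eqVlt; apply/orP; left; apply/eqP; field.
by rewrite expf_neq0//= lt0r_neq0.
Qed.

(** Identity theorem: infinitely many zeros in a small disc, compared with the
    disc where f is bounded, force f to vanish on the small disc. *)
Lemma identity_disc f c (d M : R) : 0 < d ->
  (forall z, normc (z - c) < 7 * d -> differentiable (f : C -> C) (z : C)) ->
  (forall z, normc (z - c) < 7 * d -> normc (f z) <= M) ->
  infinite_set [set w : C | normc (w - c : R[i]) < d / 8 /\ f w = 0] ->
  forall z, normc (z - c) < d / 8 -> f z = 0.
Proof.
move=> d0 hd hM inf z zc; apply/eqP; rewrite -normc_eq0 eq_le normc_ge0 andbT.
have M0 : 0 <= M.
  by apply: le_trans (hM c _); rewrite ?normc_ge0// subrr normc0 mulr_gt0.
have hf : holo_off f [::] c (7 * d).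
  by split=> [z' z'c|z' z'c _]; [apply: differentiable_continuous|]; exact: hd.
apply/ler_addgt0Pr => e e0; rewrite add0r.
pose n := Num.bound (M / e).
have Mn : M / 2 ^+ n <= e.
  rewrite ler_pdivrMr ?exprn_gt0// mulrC -ler_pdivrMr// ltW//.
  exact: upper_nthrootP.
have [X XA nX] := infinite_set_fset n inf.
apply: le_trans Mn.
apply: le_trans (@zeros_bound c d (finmap.enum_fset X) d0 f [::] M _ _ hf M0 _ z zc _) _ => //.
- exact: finmap.fset_uniq.
- by move=> w /XA [? ?].
- by move=> z' z'c _; exact: hM.
by rewrite ler_wpM2l// lef_pV2 ?posrE ?exprn_gt0// ler_weXn2l// ler1n.
Qed.

Lemma small_avoiding S (e : R) : 0 < e -> exists2 t, normc t < e & t \notin S.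
Proof.
move=> e0.
have [r r0 hr] : exists2 r : R, 0 < r & forall p, p \in S -> p != 0 -> r <= normc p.
  elim: S => [|p S [r r0 hr]]; first by exists 1.
  have [->|p0] := eqVneq p 0.
    by exists r => // x; rewrite inE => /predU1P[->|]; [rewrite eqxx|exact: hr].
  exists (Num.min r (normc p)); first by rewrite lt_min r0 normc_gt0.
  move=> x; rewrite inE ge_min => /predU1P[->|xS x0]; first by rewrite lexx orbT.
  by rewrite hr.
pose t := Num.min r e / 2.
have t0 : 0 < t by rewrite divr_gt0// lt_min r0.
have mr : Num.min r e <= r by rewrite ge_min lexx.
have me : Num.min r e <= e by rewrite ge_min lexx orbT.
have tr : t < r by rewrite /t; lra.
have te : t < e by rewrite /t; lra.
exists t%:C; first by rewrite normc_real ger0_norm// ltW.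
have tn0 : t%:C != 0 by rewrite -normc_gt0 normc_real normr_gt0 lt0r_neq0.
apply/negP => /hr /(_ tn0).
by rewrite normc_real ger0_norm ?(ltW t0)// leNgt tr.
Qed.

(** Second divided differences are bounded; the denominators are multiplied out,
    so that coinciding arguments are allowed.  Away from S this is two
    applications of [dslope]; a small common translation of z, w and w', which
    leaves the right-hand side unchanged, takes care of S. *)
Lemma second_difference f S c (d M : R) z w w' : 0 < d -> 0 <= M ->
  holo_off f S c (7 * d) ->
  (forall x, normc (x - c) < 7 * d -> normc (f x) <= M) ->
  normc (z - c) < d / 2 -> normc (w - c) < d / 2 -> normc (w' - c) < d / 2 ->
  normc ((f z - f w) * (w' - w) - (f w' - f w) * (z - w)) <=
  16 * M / d ^+ 2 * (normc (z - w') * normc (z - w) * normc (w' - w)).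
Proof.
move=> d0 M0 hf hM.
have K0 : 0 <= 16 * M / d ^+ 2 by rewrite divr_ge0 ?exprn_ge0 ?(ltW d0)// mulr_ge0.
have generic x y y' : x \notin S -> y \notin S -> y' \notin S ->
    normc (x - c) < d / 2 -> normc (y - c) < d / 2 -> normc (y' - c) < d / 2 ->
    normc ((f x - f y) * (y' - y) - (f y' - f y) * (x - y)) <=
    16 * M / d ^+ 2 * (normc (x - y') * normc (x - y) * normc (y' - y)).
  move=> xS yS y'S xc yc y'c.
  have [->|xy] := eqVneq x y.
    by rewrite !subrr mul0r mulr0 subrr !normc0 mulr0 mul0r mulr0.
  have [->|y'y] := eqVneq y' y.
    by rewrite !subrr mul0r mulr0 subrr !normc0 mulr0 mulr0.
  have [->|xy'] := eqVneq x y'; first by rewrite !subrr !normc0 !mul0r mulr0.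
  have M2 : 0 <= 2 * M by rewrite mulr_ge0.
  have hB x' : d < normc (x' - c) < 7 * d -> x' \notin S -> normc (f x' - f y) <= 2 * M.
    move=> /andP[_ x'7] _; apply: le_trans (le_normcD _ _) _; rewrite normcN.
    have := hM _ x'7; have y7 : normc (y - c) < 7 * d by lra.
    by have := hM _ y7; lra.
  have [q [hq qE qB]] := dslope d0 M2 hf yS yc hB.
  have y'yS : y' \notin y :: S by rewrite inE negb_or y'y.
  have M4 : 0 <= 2 * (2 * (2 * M) / d) by rewrite mulr_ge0// divr_ge0 ?(ltW d0)// mulr_ge0.
  have hB' x' : d < normc (x' - c) < 7 * d -> x' \notin y :: S ->
      normc (q x' - q y') <= 2 * (2 * (2 * M) / d).
    move=> /andP[_ x'7] x'S; apply: le_trans (le_normcD _ _) _; rewrite normcN.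
    have := qB _ x'7 x'S; have y7 : normc (y' - c) < 7 * d by lra.
    by have := qB _ y7 y'yS; lra.
  have [q' [hq' q'E q'B]] := dslope d0 M4 hq y'yS y'c hB'.
  have nxy : x - y != 0 by rewrite subr_eq0.
  have ny'y : y' - y != 0 by rewrite subr_eq0.
  have nxy' : x - y' != 0 by rewrite subr_eq0.
  have -> : (f x - f y) * (y' - y) - (f y' - f y) * (x - y) =
      q' x * ((x - y') * (x - y) * (y' - y)).
    by rewrite q'E// !qE//; field; rewrite ny'y nxy nxy'.
  rewrite !normcM ler_wpM2r ?mulr_ge0 ?normc_ge0//.
  have -> : 16 * M / d ^+ 2 = 2 * (2 * (2 * (2 * M) / d)) / d by field; rewrite lt0r_neq0.
  by apply: q'B; [lra|rewrite !inE !negb_or xy' xy].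
move=> zc wc w'c; apply/ler_addgt0Pr => e e0.
pose T := normc (w' - w) + normc (z - w).
have T0 : 0 <= T by rewrite addr_ge0 ?normc_ge0.
pose eta := e / (2 * T + 1).
have eta0 : 0 < eta by rewrite divr_gt0//; lra.
have cont x : normc (x - c) < d / 2 -> exists2 r : R, 0 < r &
    forall t, normc t < r -> normc (f (x + t) - f x) < eta /\ normc (x + t - c) < d / 2.
  move=> xc; have /continuous_normcP /(_ _ eta0)[r r0 hr] := hf.1 x ltac:(lra).
  exists (Num.min r (d / 2 - normc (x - c))); first by rewrite lt_min r0 subr_gt0.
  move=> t; rewrite lt_min => /andP[tr td]; split.
    by apply: hr; rewrite addrAC subrr add0r.
  by rewrite addrAC; apply: le_lt_trans (le_normcD _ _) _; lra.
have [r1 r10 h1] := cont _ zc; have [r2 r20 h2] := cont _ wc.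
have [r3 r30 h3] := cont _ w'c.
pose avoid := [seq p - z | p <- S] ++ [seq p - w | p <- S] ++ [seq p - w' | p <- S].
have [|t] := @small_avoiding avoid (Num.min r1 (Num.min r2 r3)).
  by rewrite !lt_min r10 r20.
rewrite !lt_min => /and3P[/h1[fz zt] /h2[fw wt] /h3[fw' wt']].
rewrite !mem_cat !negb_or => /and3P[tz tw tw'].
have notS x : t \notin [seq p - x | p <- S] -> x + t \notin S.
  apply: contra => xS; apply/mapP; exists (x + t) => //; by rewrite addrAC subrr add0r.
have := generic (z + t) (w + t) (w' + t) (notS _ tz) (notS _ tw) (notS _ tw') zt wt wt'.
have shiftE x y : x + t - (y + t) = x - y by ring.
rewrite !shiftE => G.
pose E := (f (z + t) - f z - (f (w + t) - f w)) * (w' - w)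
   - (f (w' + t) - f w' - (f (w + t) - f w)) * (z - w).
have -> : (f z - f w) * (w' - w) - (f w' - f w) * (z - w) =
   (f (z + t) - f (w + t)) * (w' - w) - (f (w' + t) - f (w + t)) * (z - w) - E.
  by rewrite /E; ring.
apply: le_trans (le_normcD _ _) _; rewrite normcN; apply: lerD => //.
have tri a b : normc a < eta -> normc b < eta -> normc (a - b) <= 2 * eta.
  by move=> ? ?; apply: le_trans (le_normcD _ _) _; rewrite normcN; lra.
rewrite /E; apply: le_trans (le_normcD _ _) _; rewrite normcN !normcM.
have H1 := ler_wpM2r (normc_ge0 (w' - w)) (tri _ _ fz fw).
have H2 := ler_wpM2r (normc_ge0 (z - w)) (tri _ _ fw' fw).
apply: le_trans (lerD H1 H2) _; rewrite -mulrDr -/T.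
have -> : e = eta * (2 * T + 1) by rewrite /eta divfK// lt0r_neq0//; lra.
have key (u v : R) : 0 < u -> 2 * u * v <= u * (2 * v + 1) by move=> ?; lra.
exact: key.
Qed.

End DividedDifferences.

(** * First order expansions with quadratic error *)

Section SecondOrder.
Variable R : realType.
Local Notation C := (Cpx R).
Implicit Types (f : R[i] -> R[i]) (S : seq R[i]) (z w : R[i]).

(** A Lipschitz function on a punctured disc has a limit at the centre, given
    here as a supremum. *)
Lemma lipschitz_limit_real (u : R[i] -> R) (K r : R) : 0 < r -> 0 <= K ->
  (forall z w, 0 < normc z < r -> 0 < normc w < r -> u z - u w <= K * normc (z - w)) ->
  exists l, forall z, 0 < normc z < r -> `|u z - l| <= K * normc z.
Proof.
move=> r0 K0 h.
pose E := [set x | exists2 z : R[i], 0 < normc z < r & x = u z - K * normc z].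
have key z w : 0 < normc z < r -> 0 < normc w < r -> u z - K * normc z <= u w + K * normc w.
  move=> hz hw; have := h _ _ hz hw.
  have := ler_wpM2l K0 (le_normcD z (- w)); rewrite normcN mulrDr; lra.
have r2 : 0 < normc ((r / 2)%:C : R[i]) < r by rewrite normc_real ger0_norm; lra.
exists (sup E) => z hz; rewrite ler_norml; apply/andP; split.
  suff : sup E <= u z + K * normc z by lra.
  apply: ge_sup; first by exists (u (r / 2)%:C - K * normc ((r / 2)%:C : R[i])), (r / 2)%:C.
  by move=> _ [w hw ->]; exact: key.
suff : u z - K * normc z <= sup E by lra.
apply: ub_le_sup; last by exists z.
by exists (u z + K * normc z) => _ [w hw ->]; exact: key.
Qed.

Lemma lipschitz_limit f (K r : R) : 0 < r -> 0 <= K ->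
  (forall z w, 0 < normc z < r -> 0 < normc w < r -> normc (f z - f w) <= K * normc (z - w)) ->
  exists l, forall z, 0 < normc z < r -> normc (f z - l) <= 2 * K * normc z.
Proof.
move=> r0 K0 h.
have [|a ha] := @lipschitz_limit_real (fun z => complex.Re (f z)) K r r0 K0.
  move=> z w hz hw; apply: le_trans (h _ _ hz hw); apply: le_trans (normRe_le _).
  by rewrite raddfB ler_norm.
have [|b hb] := @lipschitz_limit_real (fun z => complex.Im (f z)) K r r0 K0.
  move=> z w hz hw; apply: le_trans (h _ _ hz hw); apply: le_trans (normIm_le _).
  by rewrite raddfB ler_norm.
exists (a +i* b) => z hz; apply: le_trans (normc_le_ReIm _) _.
rewrite !raddfB /=; have := ha _ hz; have := hb _ hz; lra.
Qed.

Lemma linear_approx f S (d M : R) : 0 < d -> 0 <= M -> holo_off f S 0 (7 * d) ->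
  (forall x, normc x < 7 * d -> normc (f x) <= M) ->
  exists a, forall z, normc z < d / 2 ->
    normc (f z - f 0 - a * z) <= 32 * M / d ^+ 2 * normc z ^+ 2.
Proof.
move=> d0 M0 hf hM.
have K0 : 0 <= 16 * M / d ^+ 2 by rewrite divr_ge0 ?exprn_ge0 ?(ltW d0)// mulr_ge0.
have d2 : 0 < d / 2 by rewrite divr_gt0.
have [|a ha] := @lipschitz_limit (fun z => (f z - f 0) / z) (16 * M / d ^+ 2) (d / 2) d2 K0.
  move=> z w /andP[z0 zd] /andP[w0 wd].
  have hM' x : normc (x - 0) < 7 * d -> normc (f x) <= M by rewrite subr0; exact: hM.
  have := @second_difference _ f S 0 d M z 0 w d0 M0 hf hM'.
  rewrite !subr0 normc0 => /(_ zd d2 wd).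
  have zn0 : z != 0 by rewrite -normc_gt0.
  have wn0 : w != 0 by rewrite -normc_gt0.
  have -> : (f z - f 0) * w - (f w - f 0) * z = ((f z - f 0) / z - (f w - f 0) / w) * (z * w).
    by field; rewrite ?zn0 ?wn0.
  have n0 : 0 < normc (z * w) by rewrite normcM mulr_gt0.
  move=> H; rewrite -(ler_pM2r n0) -normcM; apply: le_trans H _.
  by rewrite normcM !mulrA.
exists a => z zd; have [->|z0] := eqVneq z 0.
  by rewrite subrr mulr0 subr0 normc0 expr0n mulr0.
have -> : f z - f 0 - a * z = ((f z - f 0) / z - a) * z by field.
rewrite normcM expr2 mulrA ler_wpM2r ?normc_ge0//.
apply: le_trans (ha _ _) _; first by rewrite normc_gt0 z0.
by rewrite le_eqVlt; apply/orP; left; apply/eqP; ring.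
Qed.

Lemma symmetric_difference f S (d M : R) z : 0 < d -> 0 <= M -> holo_off f S 0 (7 * d) ->
  (forall x, normc x < 7 * d -> normc (f x) <= M) -> normc z < d / 2 ->
  normc (f z + f (- z) - 2 * f 0) <= 32 * M / d ^+ 2 * normc z ^+ 2.
Proof.
move=> d0 M0 hf hM zd.
have [->|z0] := eqVneq z 0.
  rewrite oppr0 normc0 expr0n mulr0.
  have -> : f 0 + f 0 - 2 * f 0 = 0 by ring.
  by rewrite normc0.
have hM' x : normc (x - 0) < 7 * d -> normc (f x) <= M by rewrite subr0; exact: hM.
have := @second_difference _ f S 0 d M z 0 (- z) d0 M0 hf hM'.
have d2 : 0 < d / 2 by rewrite divr_gt0.
rewrite !subr0 normc0 normcN => /(_ zd d2 zd).
have -> : (f z - f 0) * - z - (f (- z) - f 0) * z = - (f z + f (- z) - 2 * f 0) * z by ring.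
have -> : z - - z = 2 * z by ring.
rewrite !normcM !normcN.
have -> : normc (2 : R[i]) = 2 by rewrite -[X in normc X](rmorph_nat (real_complex R)) normc_real ger0_norm.
rewrite mulrA -(mulrA _ _ (normc z)) mulrA => H.
rewrite -(@ler_pM2r _ (normc z)) ?normc_gt0//.
apply: le_trans H _.
by rewrite le_eqVlt; apply/orP; left; apply/eqP; ring.
Qed.

End SecondOrder.

(** * Functions of two complex variables *)

Section TwoVariables.
Variable R : realType.
Local Notation C := (Cpx R).
Local Notation C2 := (Cpx2 R).
Implicit Types (h : R[i] * R[i] -> R[i]) (x y : R[i]) (p : R[i] * R[i]).

Lemma nbhs2P p (P : set C2) : nbhs (p : C2) P <->
  exists2 r : R, 0 < r &
    forall x y, normc (x - p.1) < r -> normc (y - p.2) < r -> P (x, y).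
Proof.
split=> [[[A B] /= [/nbhs_normc[r1 r10 h1] /nbhs_normc[r2 r20 h2]] AB]|[r r0 hr]].
  exists (Num.min r1 r2); first by rewrite lt_min r10.
  move=> x y; rewrite !lt_min => /andP[xr _] /andP[_ yr].
  by apply: AB; split; [exact: h1|exact: h2].
exists ([set x : C | normc (x - p.1 : R[i]) < r], [set y : C | normc (y - p.2 : R[i]) < r]).
  by split; apply/nbhs_normc; exists r.
by move=> [x y] [/= xr yr]; exact: hr.
Qed.

Lemma continuous2P h p : {for (p : C2), continuous (h : C2 -> C)} <->
  forall e : R, 0 < e -> exists2 r : R, 0 < r & forall x y,
    normc (x - p.1) < r -> normc (y - p.2) < r -> normc (h (x, y) - h p) < e.
Proof.
split=> [hc e e0|hc].
  have : nbhs (h p : C) [set z' : C | normc (z' - h p : R[i]) < e].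
    by apply/nbhs_normc; exists e.
  by move=> /hc /nbhs2P.
move=> A /nbhs_normc[e e0 he]; apply/nbhs2P.
by have [r r0 hr] := hc _ e0; exists r => // x y xr yr; apply: he; exact: hr.
Qed.

Lemma eq_differentiable (K : numFieldType) (V W : normedModType K) (f g : V -> W) (x : V) :
  f =1 g -> differentiable f x -> differentiable g x.
Proof. by move/funext => ->. Qed.

Lemma near_eq_differentiable (K : numFieldType) (V W : normedModType K) (f g : V -> W) (x : V) :
  (\forall z \near x, f z = g z) -> differentiable f x -> differentiable g x.
Proof.
move=> fg df; have fgx : f x = g x by exact: nbhs_singleton fg.
apply: (@near_differentiable _ _ _ _ _ ('d f x)); first exact: diff_continuous.
move=> e e0; have := differentiable_nearP df e0.
have : \forall h \near (0 : V), f (h + x) = g (h + x).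
  by move: fg; rewrite (near_shift 0) subr0.
by apply: filterS2 => v ->; rewrite fgx.
Qed.

Lemma differentiable2P h p : differentiable (h : C2 -> C) (p : C2) <->
  exists a b : R[i], forall e : R, 0 < e -> exists2 r : R, 0 < r & forall x y,
    normc (x - p.1) < r -> normc (y - p.2) < r ->
    normc (h (x, y) - h p - a * (x - p.1) - b * (y - p.2)) <=
      e * (normc (x - p.1) + normc (y - p.2)).
Proof.
split.
  move=> dh; pose D := 'd (h : C2 -> C) (p : C2).
  exists (D (1, 0)), (D (0, 1)) => e e0.
  have e0' : 0 < e%:C by rewrite ltcR.
  have /nbhs2P[r r0 hr] := differentiable_nearP dh e0'.
  exists r => // x y xr yr.
  have := hr (x - p.1) (y - p.2); rewrite !subr0 => /(_ xr yr).
  have -> : ((x - p.1, y - p.2) : C2) + p = (x, y).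
    by case: (p) => p1 p2; congr (_, _); exact: subrK.
  have -> : 'd (h : C2 -> C) (p : C2) (x - p.1, y - p.2) =
      D (1, 0) * (x - p.1) + D (0, 1) * (y - p.2) :> R[i].
    have -> : ((x - p.1, y - p.2) : C2) =
       ((x - p.1) : R[i]) *: ((1, 0) : C2) + ((y - p.2) : R[i]) *: ((0, 1) : C2).
      congr (_, _); rewrite /= /GRing.scale/=.
        by rewrite mulr1 mulr0 addr0.
      by rewrite mulr1 mulr0 add0r.
    rewrite linearD !linearZ /GRing.scale/=.
    by congr (_ + _); exact: mulrC.
  rewrite opprD addrA => H.
  rewrite -lecR -norm_normc; apply: le_trans H _.
  rewrite rmorphM ler_pM2l ?ltcR// rmorphD/= -!norm_normc.
  by rewrite prod_normE/= maxElt; case: ifP => _; rewrite ?lerDl ?lerDr.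
case=> a [b H].
pose L (v : C2) : C := (a : R[i]) * v.1 + b * v.2.
have lin_L : linear L.
  by move=> k u v; rewrite /L /= /GRing.scale/=; ring.
pose scallM := GRing.isLinear.Build _ _ _ _ _ lin_L.
pose LL : {linear C2 -> C} := HB.pack L scallM.
have cL : continuous LL.
  move=> v; apply: (@continuousD R[i] C C2 (fun v : C2 => (a : C) * v.1 : C) (fun v : C2 => (b : C) * v.2 : C) v).
    apply: (@continuousM R[i] C2 (cst (a : C)) fst v); [exact: cst_continuous|exact: cvg_fst].
  apply: (@continuousM R[i] C2 (cst (b : C)) snd v); [exact: cst_continuous|exact: cvg_snd].
apply: (@near_differentiable _ _ _ _ _ LL) => // e e0.
have eE : e = (complex.Re e)%:C by rewrite RRe_real// gtr0_real.
have e2 : 0 < complex.Re e / 2 by rewrite divr_gt0// -ltcR -eE.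
have [r r0 hr] := H _ e2.
apply/nbhs2P; exists r => // x y; rewrite !subr0 => xr yr.
have := hr (x + p.1) (y + p.2); rewrite !addrK => /(_ xr yr).
have -> : ((x, y) : C2) + p = (x + p.1, y + p.2) by case: (p).
have -> : LL (x, y) = a * x + b * y by [].
rewrite opprD addrA -lecR -norm_normc => /le_trans; apply.
have eE2 : e = (complex.Re e / 2)%:C *+ 2.
  by rewrite {1}eE -raddfMn; congr _%:C; rewrite mulr2n; field.
rewrite [X in _ <= X * _]eE2; move: (complex.Re e / 2) e2 => k k0.
have {}k0 : 0 <= k%:C by rewrite lecR ltW.
rewrite rmorphM mulrnAl -mulrnAr; apply: ler_wpM2l => //.
rewrite rmorphD/= -!norm_normc mulr2n prod_normE/=.
have cmp : (`|x| >=< `|y|)%R by rewrite real_comparable.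
by apply: lerD; rewrite comparable_le_max// lexx ?orbT.
Qed.

Lemma differentiable_line h p (a b z : R[i]) :
  differentiable (h : C2 -> C) ((p.1 + z * a, p.2 + z * b) : C2) ->
  differentiable (fun z : C => h (p.1 + z * a, p.2 + z * b) : C) (z : C).
Proof.
move=> dh.
apply: (@differentiable_comp_K R[i] C C2 C (fun z : C => (p.1 + z * a, p.2 + z * b) : C2) h) => //.
Qed.

Lemma continuous_line h p (a b z : R[i]) :
  {for ((p.1 + z * a, p.2 + z * b) : C2), continuous (h : C2 -> C)} ->
  {for (z : C), continuous (fun z : C => h (p.1 + z * a, p.2 + z * b) : C)}.
Proof.
move=> /continuous2P ch; apply/(continuous_normcP (fun z => h (p.1 + z * a, p.2 + z * b))).
move=> e e0; have [r r0 hr] := ch _ e0.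
pose N := normc a + normc b + 1.
have N0 : 0 < N by have := normc_ge0 a; have := normc_ge0 b; rewrite /N; lra.
exists (r / N); first by rewrite divr_gt0.
move=> z' z'z; apply: hr => /=.
  have -> : p.1 + z' * a - (p.1 + z * a) = (z' - z) * a by ring.
  rewrite normcM; apply: (@le_lt_trans _ _ (normc (z' - z) * N)).
    by rewrite ler_wpM2l ?normc_ge0// /N; have := normc_ge0 b; lra.
  by rewrite -ltr_pdivlMr.
have -> : p.2 + z' * b - (p.2 + z * b) = (z' - z) * b by ring.
rewrite normcM; apply: (@le_lt_trans _ _ (normc (z' - z) * N)).
  by rewrite ler_wpM2l ?normc_ge0// /N; have := normc_ge0 a; lra.
by rewrite -ltr_pdivlMr.
Qed.

(** A point is removable for a function of two variables that is continuous
    there and complex differentiable elsewhere.  The candidate derivative is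
    read off the two axes.  A point (x, y) is the midpoint of (2x, 0) and
    (0, 2y), and the second difference of h along the line through them is
    quadratically small. *)
Lemma removable_origin h (rho M : R) : 0 < rho ->
  {for ((0, 0) : C2), continuous (h : C2 -> C)} ->
  (forall x y, normc x < rho -> normc y < rho -> (x, y) != (0, 0) ->
    differentiable (h : C2 -> C) ((x, y) : C2)) ->
  (forall x y, normc x < rho -> normc y < rho -> normc (h (x, y)) <= M) ->
  differentiable (h : C2 -> C) ((0, 0) : C2).
Proof.
move=> rho0 hc hd hM.
have cont x y : normc x < rho -> normc y < rho ->
    {for ((x, y) : C2), continuous (h : C2 -> C)}.
  move=> xr yr; have [[-> ->]//|xy] := eqVneq (x, y) (0, 0).
  by apply: differentiable_continuous; exact: hd.
have M0 : 0 <= M by apply: le_trans (hM 0 0 _ _); rewrite ?normc_ge0 ?normc0.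
(* h on the complex line through p with direction (a, b); S contains the
   parameters at which the line may meet the origin *)
have slice S p a b (d : R) :
    normc p.1 + 7 * d * normc a < rho -> normc p.2 + 7 * d * normc b < rho ->
    (forall z, z \notin S -> (p.1 + z * a, p.2 + z * b) != (0, 0)) ->
    holo_off (fun z => h (p.1 + z * a, p.2 + z * b)) S 0 (7 * d) /\
    (forall z, normc z < 7 * d -> normc (h (p.1 + z * a, p.2 + z * b)) <= M).
  move=> ha hb hS.
  have box z : normc z < 7 * d -> normc (p.1 + z * a) < rho /\ normc (p.2 + z * b) < rho.
    move=> zd; split; apply: le_lt_trans (le_normcD _ _) _.
      by apply: le_lt_trans ha; rewrite lerD2l normcM ler_wpM2r ?normc_ge0// ltW.
    by apply: le_lt_trans hb; rewrite lerD2l normcM ler_wpM2r ?normc_ge0// ltW.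
  split; last by move=> z /box[? ?]; exact: hM.
  split=> z; rewrite subr0 => /box[b1 b2].
    by apply: continuous_line; exact: cont.
  by move=> /hS nz; apply: differentiable_line; exact: hd.
have r14 : 0 < rho / 14 by rewrite divr_gt0.
pose k := 32 * M / (rho / 14) ^+ 2.
have k0 : 0 <= k by rewrite divr_ge0 ?exprn_ge0 ?(ltW r14)// mulr_ge0.
have n0 : normc (0 : R[i]) = 0 by exact: normc0.
have n1 : normc (1 : R[i]) = 1 by exact: normc1.
have H1 : normc (0 : R[i]) + 7 * (rho / 14) * normc (1 : R[i]) < rho by rewrite n0 n1; lra.
have H0 : normc (0 : R[i]) + 7 * (rho / 14) * normc (0 : R[i]) < rho by rewrite n0; lra.
have [|hx bx] := slice [:: 0] (0, 0) 1 0 (rho / 14) H1 H0.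
  by move=> z; rewrite inE => z0; rewrite mulr1 add0r xpair_eqE negb_and z0.
have [|hy by_] := slice [:: 0] (0, 0) 0 1 (rho / 14) H0 H1.
  by move=> z; rewrite inE => z0; rewrite mulr1 !add0r xpair_eqE negb_and z0 orbT.
have [a ha] := linear_approx r14 M0 hx bx.
have [b hb] := linear_approx r14 M0 hy by_.
have {}ha x : normc x < rho / 28 -> normc (h (x, 0) - h (0, 0) - a * x) <= k * normc x ^+ 2.
  move=> xr; have := ha x; cbn [fst snd]; rewrite !mul0r !mulr0 !mulr1 !addr0 ?add0r; apply; lra.
have {}hb x : normc x < rho / 28 -> normc (h (0, x) - h (0, 0) - b * x) <= k * normc x ^+ 2.
  move=> xr; have := hb x; cbn [fst snd]; rewrite !mul0r !mulr0 !mulr1 !addr0 ?add0r; apply; lra.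
have n2 x : normc (2 * x) = 2 * normc x.
  by rewrite normcM -[X in normc X](rmorph_nat (real_complex R)) normc_real ger0_norm.
have mid x y : 0 < normc x + normc y < rho / 56 ->
    normc (h (2 * x, 0) + h (0, 2 * y) - 2 * h (x, y)) <= k * (normc x + normc y) ^+ 2.
  set N := normc x + normc y => /andP[N0 Nr].
  have xN : normc x <= N by rewrite lerDl normc_ge0.
  have yN : normc y <= N by rewrite lerDr normc_ge0.
  (* the size of the disc of parameters is inversely proportional to N, which
     makes the bound of [symmetric_difference] at 1 quadratic in N *)
  pose d := rho / (14 * N).
  have d0 : 0 < d by rewrite divr_gt0// mulr_gt0.
  have dN : 7 * d * N = rho / 2 by rewrite /d; field; rewrite lt0r_neq0.
  have small u : normc u <= N -> normc u + 7 * d * normc u < rho.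
    move=> uN; have : 7 * d * normc u <= 7 * d * N by rewrite ler_wpM2l// mulr_ge0// ltW.
    rewrite dN; lra.
  have [|||hg bg] := @slice [:: 1; -1] (x, y) x (- y) d.
  - exact: small.
  - by rewrite normcN; exact: small.
  - move=> z; rewrite !inE negb_or => /andP[z1 z2]; cbn [fst snd].
    have -> : x + z * x = (z - -1) * x by ring.
    have -> : y + z * - y = - ((z - 1) * y) by ring.
    rewrite xpair_eqE oppr_eq0 !mulf_eq0 !subr_eq0 (negbTE z1) (negbTE z2) /=.
    apply/negP => /andP[/eqP x0 /eqP y0].
    by move: N0; rewrite /N x0 y0 n0 addr0 ltxx.
  have d2 : normc (1 : R[i]) < d / 2.
    rewrite n1 /d ltr_pdivlMr// mul1r ltr_pdivlMr ?mulr_gt0//; lra.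
  have := symmetric_difference d0 M0 hg bg d2.
  cbn [fst snd]; rewrite n1 expr1n mulr1 !mul1r !mulN1r mul0r !opprK addrN mul0r !addr0 subrr.
  have -> : x + x = 2 * x by ring.
  have -> : y + y = 2 * y by ring.
  have -> : 32 * M / d ^+ 2 = k * N ^+ 2 by rewrite /k /d; field; rewrite !lt0r_neq0.
  by [].
apply/differentiable2P; exists a, b => e e0.
exists (Num.min (rho / 112) (e / (6 * k + 1))).
  by rewrite lt_min !divr_gt0//; lra.
move=> x y; cbn [fst snd]; rewrite !subr0 !lt_min => /andP[x1 x2] /andP[y1 y2].
set N := normc x + normc y.
have [N0|N0] := ltP 0 N; last first.
  have /eqP : normc x == 0.
    by rewrite eq_le normc_ge0 andbT; have := normc_ge0 y; rewrite /N in N0; lra.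
  move=> /eq0_normc ->; have /eqP : normc y == 0.
    by rewrite eq_le normc_ge0 andbT; have := normc_ge0 x; rewrite /N in N0; lra.
  move=> /eq0_normc ->; rewrite !mulr0 !subr0 subrr normc0 mulr_ge0 ?(ltW e0)//.
  by rewrite /N addr_ge0 ?normc_ge0.
have hN : 0 < normc x + normc y < rho / 56 by rewrite -/N N0 /N; lra.
have {}H1 := mid x y hN.
have x2r : normc (2 * x) < rho / 28 by rewrite n2; lra.
have y2r : normc (2 * y) < rho / 28 by rewrite n2; lra.
have H2 := ha _ x2r; have H3 := hb _ y2r; rewrite !n2 in H2 H3.
have E : 2 * (h (x, y) - h (0, 0) - a * x - b * y) =
   (h (2 * x, 0) - h (0, 0) - a * (2 * x)) + (h (0, 2 * y) - h (0, 0) - b * (2 * y))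
   - (h (2 * x, 0) + h (0, 2 * y) - 2 * h (x, y)) by ring.
have H : 2 * normc (h (x, y) - h (0, 0) - a * x - b * y) <= 5 * (k * N ^+ 2).
  rewrite -n2 E; apply: le_trans (le_normcD _ _) _; rewrite normcN.
  apply: le_trans (lerD (le_normcD _ _) (lexx _)) _.
  have : 0 <= k * (normc x * normc y) by rewrite mulr_ge0// mulr_ge0 ?normc_ge0.
  move: H1 H2 H3; rewrite /N !exprMn !expr2.
  have -> : (normc x + normc y) * (normc x + normc y) =
    normc x * normc x + 2 * (normc x * normc y) + normc y * normc y by ring.
  rewrite !(mulrDr k) !(mulrCA k).
  lra.
have kN : 3 * (k * N) <= e.
  have : N <= 2 * (e / (6 * k + 1)) by rewrite /N; lra.
  move=> /(ler_wpM2l k0) kN.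
  have : k * (2 * (e / (6 * k + 1))) * 3 <= e.
    rewrite [leLHS](_ : _ = e * (6 * k) / (6 * k + 1)); last by field; lra.
    rewrite ler_pdivrMr; last by lra.
    by rewrite ler_pM2l//; lra.
  lra.
have := ler_wpM2r (ltW N0) kN; rewrite expr2 in H.
have : 0 <= k * N * N by do 2![apply: mulr_ge0 => //; last exact: ltW].
lra.
Qed.

(** Identity theorem in two variables: vanishing on a product of two infinite
    sets close to p forces vanishing on a neighbourhood of p whose size does not
    depend on these sets. *)
Lemma identity_box h p : (\forall q \near (p : C2), differentiable (h : C2 -> C) q) ->
  exists2 e : R, 0 < e & forall E1 E2 : set C, infinite_set E1 -> infinite_set E2 ->
    (forall x : R[i], E1 x -> normc (x - p.1) < e) ->
    (forall y : R[i], E2 y -> normc (y - p.2) < e) ->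
    (forall x y, E1 x -> E2 y -> h (x, y) = 0) ->
    forall x y, normc (x - p.1) < e -> normc (y - p.2) < e -> h (x, y) = 0.
Proof.
move=> /nbhs2P[r1 r10 hd].
have hp : differentiable (h : C2 -> C) (p : C2).
  by have := hd p.1 p.2; rewrite !subrr normc0 -surjective_pairing; apply.
have [r2 r20 hb] := (continuous2P _ _).1 (differentiable_continuous hp) 1 ltr01.
pose M := normc (h p) + 1.
have hM x y : normc (x - p.1) < r2 -> normc (y - p.2) < r2 -> normc (h (x, y)) <= M.
  move=> xr yr; have := hb _ _ xr yr; have := le_normcD (h (x, y) - h p) (h p).
  by rewrite subrK /M; lra.
pose d := Num.min r1 r2 / 7.
have d0 : 0 < d by rewrite divr_gt0// lt_min r10.
have d1 : 7 * d <= r1 by rewrite /d mulrC divfK// ge_min lexx.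
have d2 : 7 * d <= r2 by rewrite /d mulrC divfK// ge_min lexx orbT.
exists (d / 8); first by rewrite divr_gt0.
move=> E1 E2 inf1 inf2 s1 s2 h0.
have lx x y : normc (x - p.1) < 7 * d -> normc (y - p.2) < 7 * d ->
    differentiable (fun y : C => h (x, y) : C) (y : C).
  move=> xd yd.
  apply: (@eq_differentiable_C _ (fun z => h ((x, 0).1 + z * 0, (x, 0).2 + z * 1))).
    by move=> z; rewrite /= mulr0 mulr1 addr0 add0r.
  apply: differentiable_line => /=; rewrite mulr0 mulr1 addr0 add0r.
  by apply: hd => /=; lra.
have ly x y : normc (x - p.1) < 7 * d -> normc (y - p.2) < 7 * d ->
    differentiable (fun x : C => h (x, y) : C) (x : C).
  move=> xd yd.
  apply: (@eq_differentiable_C _ (fun z => h ((0, y).1 + z * 1, (0, y).2 + z * 0))).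
    by move=> z; rewrite /= mulr0 mulr1 addr0 add0r.
  apply: differentiable_line => /=; rewrite mulr0 mulr1 addr0 add0r.
  by apply: hd => /=; lra.
have step1 x y : E1 x -> normc (y - p.2) < d / 8 -> h (x, y) = 0.
  move=> xE; have xd : normc (x - p.1) < 7 * d by have := s1 _ xE; lra.
  apply: (@identity_disc _ (fun y => h (x, y)) p.2 d M d0).
  - by move=> z; exact: lx.
  - by move=> z zd; apply: hM; lra.
  - by apply: sub_infinite_set inf2 => z zE /=; split; [exact: s2|exact: h0].
move=> x y xd yd.
have yd7 : normc (y - p.2) < 7 * d by lra.
apply: (@identity_disc _ (fun x => h (x, y)) p.1 d M d0) => //.
- by move=> z zd; exact: ly.
- by move=> z zd; apply: hM; lra.
- by apply: sub_infinite_set inf1 => z zE /=; split; [exact: s1|exact: step1].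
Qed.

End TwoVariables.

(** * Division by the coordinates *)

Section Division.
Variable R : realType.
Local Notation C := (Cpx R).
Local Notation C2 := (Cpx2 R).
Implicit Types (h P Q : R[i] * R[i] -> R[i]) (x y : R[i]) (p : R[i] * R[i]).

Lemma differentiableM_C2 P Q p :
  differentiable (P : C2 -> C) (p : C2) -> differentiable (Q : C2 -> C) (p : C2) ->
  differentiable (fun q : C2 => P q * Q q : C) (p : C2).
Proof. exact: (@differentiableM R[i] C2). Qed.

Lemma differentiableD_C2 P Q p :
  differentiable (P : C2 -> C) (p : C2) -> differentiable (Q : C2 -> C) (p : C2) ->
  differentiable (fun q : C2 => P q + Q q : C) (p : C2).
Proof. exact: (@differentiableD R[i] C2 C). Qed.

Lemma differentiableV_C2 P p : differentiable (P : C2 -> C) (p : C2) -> P p != 0 ->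
  differentiable (fun q : C2 => (P q)^-1 : C) (p : C2).
Proof. exact: (@differentiableV R[i] C2). Qed.

Lemma differentiable_fst (k : R[i]) p : differentiable (fun q : C2 => k * q.1 : C) (p : C2).
Proof.
apply/(differentiable2P (fun q => k * q.1)); exists k, 0 => e e0; exists 1 => // x y _ _.
cbn [fst snd]; rewrite -mulrBr subrr sub0r mul0r oppr0 normc0.
by rewrite mulr_ge0 ?(ltW e0)// addr_ge0 ?normc_ge0.
Qed.

Lemma differentiable_snd (k : R[i]) p : differentiable (fun q : C2 => k * q.2 : C) (p : C2).
Proof.
apply/(differentiable2P (fun q => k * q.2)); exists 0, k => e e0; exists 1 => // x y _ _.
cbn [fst snd]; rewrite -mulrBr mul0r subr0 subrr normc0.
by rewrite mulr_ge0 ?(ltW e0)// addr_ge0 ?normc_ge0.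
Qed.

(** The syzygies of the two coordinate functions are multiples of the obvious
    one.  The quotient h is [P / (A x)] where x is not 0 and [- Q / (B y)] where
    y is not 0, hence it is differentiable off the origin.  At the origin its
    value is the derivative of P in x, divided by A.  The differentiability of P
    at 0 gives continuity in the cone |y| <= |x|, the maximum principle in x
    extends it to |x| < |y|, and the origin is then removable. *)
Lemma coordinate_syzygy P Q (A B : R[i]) (r : R) : A != 0 -> B != 0 -> 0 < r ->
  (forall x y, normc x < r -> normc y < r ->
    [/\ differentiable (P : C2 -> C) ((x, y) : C2), differentiable (Q : C2 -> C) ((x, y) : C2) &
      B * y * P (x, y) + A * x * Q (x, y) = 0]) ->
  exists h, exists2 r' : R, 0 < r' & forall x y, normc x < r' -> normc y < r' ->
    [/\ differentiable (h : C2 -> C) ((x, y) : C2),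
     P (x, y) = h (x, y) * (A * x) & Q (x, y) = h (x, y) * (- B * y)].
Proof.
move=> A0 B0 r0 H.
have r00 : normc (0 : R[i]) < r by rewrite normc0.
have [dP0 dQ0 _] := H 0 0 r00 r00.
have P0y y : normc y < r -> y != 0 -> P (0, y) = 0.
  move=> yr y0; have [_ _] := H 0 y r00 yr; rewrite mulr0 mul0r addr0 => /eqP.
  by rewrite !mulf_eq0 (negbTE B0) (negbTE y0) => /eqP.
have Qx0 x : normc x < r -> x != 0 -> Q (x, 0) = 0.
  move=> xr x0; have [_ _] := H x 0 xr r00; rewrite mulr0 mul0r add0r => /eqP.
  by rewrite !mulf_eq0 (negbTE A0) (negbTE x0) => /eqP.
have small (e : R) : 0 < e -> exists2 t : R[i], 0 < normc t & normc t < e.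
  move=> e0; exists (e / 2)%:C; rewrite normc_real gtr0_norm ?divr_gt0//; lra.
have vanish (F : R[i] * R[i] -> R[i]) (g : R[i] -> R[i] * R[i]) :
    differentiable (F : C2 -> C) ((0, 0) : C2) ->
    (forall t, normc (g t).1 <= normc t /\ normc (g t).2 <= normc t) ->
    (forall t, normc t < r -> t != 0 -> F (g t) = 0) -> F (0, 0) = 0.
  move=> dF gt Fg; apply/eqP; rewrite -normc_eq0 eq_le normc_ge0 andbT.
  apply/ler_addgt0Pr => e e0; rewrite add0r.
  have [d d0 hd] := (continuous2P _ _).1 (differentiable_continuous dF) _ e0.
  have [|t t0] := small (Num.min d r); first by rewrite lt_min d0.
  rewrite lt_min => /andP[td tr]; have [g1 g2] := gt t.
  have := hd (g t).1 (g t).2; cbn [fst snd]; rewrite !subr0 => /(_ (le_lt_trans g1 td) (le_lt_trans g2 td)).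
  by rewrite -surjective_pairing Fg// -?normc_gt0// sub0r normcN => /ltW.
have P00 : P (0, 0) = 0.
  apply: (vanish _ (fun t => (0, t)) dP0) => t; last exact: P0y.
  by cbn [fst snd]; rewrite normc0 normc_ge0.
have Q00 : Q (0, 0) = 0.
  apply: (vanish _ (fun t => (t, 0)) dQ0) => t; last exact: Qx0.
  by cbn [fst snd]; rewrite normc0 normc_ge0.
have [al [be hP]] := (differentiable2P _ _).1 dP0.
(* P vanishes on the axis x = 0, hence so does its derivative in y *)
have be0 : be = 0.
  apply/eqP; rewrite -normc_eq0 eq_le normc_ge0 andbT.
  apply/ler_addgt0Pr => e e0; rewrite add0r.
  have [d d0 hd] := hP _ e0.
  have [|t t0] := small (Num.min d r); first by rewrite lt_min d0.
  rewrite lt_min => /andP[td tr]; have := hd 0 t; cbn [fst snd].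
  rewrite !subr0 normc0 => /(_ d0 td); rewrite P0y// -?normc_gt0//.
  rewrite P00 mulr0 !subr0 sub0r normcN normcM add0r.
  by rewrite ler_pM2r.
pose h p : R[i] := if p.1 != 0 then P p / (A * p.1) else
  if p.2 != 0 then Q p / (- B * p.2) else al / A.
have hx p : p.1 != 0 -> h p = P p / (A * p.1) by rewrite /h => ->.
have hy x y : normc x < r -> normc y < r -> y != 0 -> h (x, y) = Q (x, y) / (- B * y).
  move=> xr yr y0; rewrite /h; cbn [fst snd]; rewrite y0.
  have [//|x0] := eqVneq x 0.
  have [_ _ E] := H x y xr yr.
  have E' : B * y * P (x, y) = - (A * x * Q (x, y)) by apply/eqP; rewrite -addr_eq0 E.
  apply/eqP; rewrite eqr_div ?mulf_neq0 ?oppr_eq0//; apply/eqP.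
  transitivity (- (B * y * P (x, y))); first by ring.
  by rewrite E'; ring.
have hPE x y : normc x < r -> normc y < r -> P (x, y) = h (x, y) * (A * x).
  move=> xr yr; have [->|x0] := eqVneq x 0; last first.
    by rewrite hx// divfK// mulf_neq0.
  by rewrite !mulr0; have [->//|y0] := eqVneq y 0; exact: P0y.
have hQE x y : normc x < r -> normc y < r -> Q (x, y) = h (x, y) * (- B * y).
  move=> xr yr; have [->|y0] := eqVneq y 0; last first.
    by rewrite hy// divfK// mulf_neq0// oppr_eq0.
  by rewrite !mulr0; have [->//|x0] := eqVneq x 0; exact: Qx0.
have dh x y : normc x < r -> normc y < r -> (x, y) != (0, 0) ->
    differentiable (h : C2 -> C) ((x, y) : C2).
  move=> xr yr; rewrite xpair_eqE negb_and; have [x0|x0] := boolP (x != 0).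
    move=> _; have [dP _ _] := H _ _ xr yr.
    apply: (@near_eq_differentiable _ C2 C (fun q : C2 => P q * (A * q.1)^-1)).
      apply/nbhs2P; exists (normc x); first by rewrite normc_gt0.
      move=> x' y' x'x _; rewrite hx//; apply: contraTneq x'x => /= ->.
      by rewrite sub0r normcN ltxx.
    apply: (@differentiableM_C2 P (fun q => (A * q.1)^-1) (x, y) dP).
    apply: (@differentiableV_C2 (fun q => A * q.1)); first exact: differentiable_fst.
    by rewrite mulf_neq0.
  rewrite orFb => y0; have [_ dQ _] := H _ _ xr yr.
  apply: (@near_eq_differentiable _ C2 C (fun q : C2 => Q q * (- B * q.2)^-1)).
    apply/nbhs2P; exists (Num.min (normc y) (Num.min (r - normc x) (r - normc y))).
      by rewrite !lt_min normc_gt0 y0 !subr_gt0 xr.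
    move=> x' y'; cbn [fst snd]; rewrite !lt_min => /and3P[_ x1 _] /and3P[y1 _ y2].
    rewrite hy//.
    - by have := le_normcD (x' - x) x; rewrite subrK; lra.
    - by have := le_normcD (y' - y) y; rewrite subrK; lra.
    - by apply: contraTneq y1 => ->; rewrite sub0r normcN ltxx.
  apply: (@differentiableM_C2 Q (fun q => (- B * q.2)^-1) (x, y) dQ).
  apply: (@differentiableV_C2 (fun q => - B * q.2)); first exact: differentiable_snd.
  by rewrite mulf_neq0// oppr_eq0.
have h0 : h (0, 0) = al / A by rewrite /h eqxx.
have nA : 0 < normc A by rewrite normc_gt0.
have ch : {for ((0, 0) : C2), continuous (h : C2 -> C)}.
  apply/continuous2P => e e0.
  pose e' := e * normc A / 4.
  have e'0 : 0 < e' by rewrite divr_gt0// mulr_gt0.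
  have [d d0 hd] := hP _ e'0.
  pose dr := Num.min d r.
  have dr0 : 0 < dr by rewrite lt_min d0.
  have diag x y : normc x < dr -> normc y < dr -> normc y <= normc x -> x != 0 ->
      normc (h (x, y) - h (0, 0)) <= e / 2.
    rewrite !lt_min => /andP[xd xr] /andP[yd yr] yx x0.
    have := hd x y; cbn [fst snd]; rewrite !subr0 => /(_ xd yd).
    rewrite P00 be0 mul0r !subr0 (hPE _ _ xr yr) h0.
    have -> : h (x, y) * (A * x) - al * x = (h (x, y) - al / A) * (A * x) by field.
    rewrite !normcM => E.
    have nx : 0 < normc x by rewrite normc_gt0.
    rewrite -(ler_pM2r (mulr_gt0 nA nx)); apply: le_trans E _.
    have : e' * (normc x + normc y) <= e' * (2 * normc x).
      by rewrite ler_wpM2l ?(ltW e'0)//; lra.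
    move/le_trans; apply; rewrite /e' le_eqVlt; apply/orP; left; apply/eqP; by field.
  exists (dr / 7); first by rewrite divr_gt0.
  move=> x y; cbn [fst snd]; rewrite !subr0 => xd yd.
  suff : normc (h (x, y) - h (0, 0)) <= e / 2 by lra.
  have e2 : 0 <= e / 2 by rewrite divr_ge0// ltW.
  have drr : dr <= r by rewrite ge_min lexx orbT.
  have [yx|xy] := leP (normc y) (normc x).
    have [x0|x0] := eqVneq x 0; last by apply: diag => //; lra.
    have y0 : y = 0.
      by apply: eq0_normc; apply/eqP; rewrite eq_le normc_ge0 andbT -(normc0 R) -x0.
    by rewrite x0 y0 subrr normc0.
  have ny : 0 < normc y by apply: le_lt_trans xy; exact: normc_ge0.
  have y0 : y != 0 by rewrite -normc_gt0.
  have df z : normc (z - 0) < 7 * normc y ->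
      differentiable (fun z : C => h (z, y) - h (0, 0) : C) (z : C).
    rewrite subr0 => zy; apply: differentiableB_C; last exact: differentiable_cst.
    apply: (@eq_differentiable_C _ (fun z => h ((0, y).1 + z * 1, (0, y).2 + z * 0))).
      by move=> t; cbn [fst snd]; rewrite mulr0 mulr1 addr0 add0r.
    apply: differentiable_line; cbn [fst snd]; rewrite mulr0 mulr1 addr0 add0r.
    by apply: dh; [lra|lra|rewrite xpair_eqE negb_and y0 orbT].
  have hof : holo_off (fun z => h (z, y) - h (0, 0)) [::] 0 (7 * normc y).
    by split=> z zy; [apply: differentiable_continuous|move=> _]; exact: df.
  apply: (max_disc ny e2 hof) => [z||//]; last by rewrite subr0; lra.
  rewrite subr0 => /andP[z1 z2] _; apply: diag; [lra|lra|exact: ltW|].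
  by rewrite -normc_gt0; lra.
have [d d0 hd] := (continuous2P _ _).1 ch _ ltr01.
have drr : 0 < Num.min d r by rewrite lt_min d0.
have dh0 : differentiable (h : C2 -> C) ((0, 0) : C2).
  apply: (@removable_origin _ h (Num.min d r) (normc (h (0, 0)) + 1) drr ch).
    by move=> x y; rewrite !lt_min => /andP[_ xr] /andP[_ yr]; exact: dh.
  move=> x y; rewrite !lt_min => /andP[xr _] /andP[yr _].
  have := hd x y; cbn [fst snd]; rewrite !subr0 => /(_ xr yr).
  by have := le_normcD (h (x, y) - h (0, 0)) (h (0, 0)); rewrite subrK; lra.
exists h, r; first exact: r0.
move=> x y xr yr; split; [|exact: hPE|exact: hQE].
by have [->|xy] := eqVneq (x, y) (0, 0); [exact: dh0|exact: dh].
Qed.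

End Division.

(** * Planar domains with circular boundary *)

Section Geometry.
Variable R : realType.
Local Notation C := (Cpx R).
Implicit Types (x y z : R[i]) (D : set C).

Lemma infinite_inj (T : Type) (u : nat -> T) (E : set T) :
  injective u -> (forall n, E (u n)) -> infinite_set E.
Proof.
move=> inju Eu; apply: (@sub_infinite_set _ (range u)); first by move=> _ [n _ <-].
have := @inj_card_eq _ _ setT u (fun m n _ _ => @inju m n).
by move/eq_finite_set => ->; exact: infinite_nat.
Qed.

Lemma divSn_inj (d : R) : d != 0 -> injective (fun n : nat => d / n.+2%:R).
Proof.
move=> d0 m n /(mulfI d0)/invr_inj/eqP; rewrite eqr_nat => /eqP; exact: (@addnI 2).
Qed.

Lemma infinite_disc x (d : R) : 0 < d -> infinite_set [set z : C | normc (z - x : R[i]) < d].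
Proof.
move=> d0; apply: (@infinite_inj _ (fun n => x + (d / n.+2%:R)%:C)).
  by move=> m n /addrI [] /(@divSn_inj _ (lt0r_neq0 d0)).
move=> n /=; rewrite addrAC subrr add0r normc_real ger0_norm ?divr_ge0 ?(ltW d0)//.
by rewrite ltr_pdivrMr// ltr_pMr// ltr1n.
Qed.

(** The rational parametrization of the circle of radius a yields infinitely
    many of its points close to a. *)
Lemma infinite_arc (a d : R) : 0 < a -> 0 < d ->
  infinite_set [set z : C | normc (z : R[i]) = a /\ normc (z - a%:C : R[i]) < d].
Proof.
move=> a0 d0.
pose e := Num.min 1 (d / (4 * a)).
have e0 : 0 < e by rewrite lt_min ltr01 divr_gt0// mulr_gt0.
pose t n : R := e / n.+2%:R.
pose w (t : R) : R[i] := ((1 - t ^+ 2) / (1 + t ^+ 2)) +i* (2 * t / (1 + t ^+ 2)).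
have p0 (s : R) : 0 < 1 + s ^+ 2 by rewrite ltr_pwDl// sqr_ge0.
have wK (s : R) : complex.Im (w s) / (1 + complex.Re (w s)) = s.
  by rewrite /=; field; have := p0 s; lra.
have nw s : normc (w s) = 1.
  rewrite /= -[RHS]sqrtr1; congr Num.sqrt.
  by field; rewrite lt0r_neq0.
apply: (@infinite_inj _ (fun n => a%:C * w (t n))).
  have ac0 : a%:C != 0 by rewrite -normc_gt0 normc_real normr_gt0 lt0r_neq0.
  move=> m n /(mulfI ac0) E; apply: (@divSn_inj e); first exact: lt0r_neq0.
  by rewrite -[LHS]wK -[RHS]wK -/(t m) -/(t n) E.
move=> n; change (normc (a%:C * w (t n)) = a /\ normc (a%:C * w (t n) - a%:C) < d).
have t0 : 0 < t n by rewrite divr_gt0.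
have te : t n < e by rewrite ltr_pdivrMr// ltr_pMr// ltr1n.
have t1 : t n < 1 by apply: lt_le_trans te _; rewrite ge_min lexx.
have td : t n < d / (4 * a) by apply: lt_le_trans te _; rewrite ge_min lexx orbT.
move: (t n) t0 t1 td {te} => s t0 t1 td.
split; first by rewrite normcM nw mulr1 normc_real gtr0_norm.
have -> : a%:C * w s - a%:C = a%:C * (w s - 1) by rewrite mulrBr mulr1.
rewrite normcM normc_real (gtr0_norm a0).
have : normc (w s - 1) <= 4 * s.
  apply: le_trans (normc_le_ReIm _) _.
  have -> : complex.Re (w s - 1) = - (2 * s ^+ 2 / (1 + s ^+ 2)).
    by rewrite raddfB /=; field; rewrite lt0r_neq0.
  have -> : complex.Im (w s - 1) = 2 * s / (1 + s ^+ 2).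
    by rewrite raddfB /=; field; rewrite lt0r_neq0.
  rewrite normrN !ger0_norm ?divr_ge0 ?mulr_ge0 ?sqr_ge0 ?(ltW (p0 _)) ?(ltW t0)//.
  rewrite -mulrDl ler_pdivrMr// !expr2.
  have : s * s <= s * 1 by rewrite ler_pM2l// ltW.
  have : 0 <= s * (s * s) by rewrite !mulr_ge0// ltW.
  by lra.
move=> H; apply: (@le_lt_trans _ _ (a * (4 * s))); first by rewrite ler_pM2l.
by move: td; rewrite ltr_pdivlMr ?mulr_gt0//; lra.
Qed.

(** Connectedness of [[0, 1]], as an induction principle. *)
Lemma segment_clopen (P : R -> Prop) : P 0 ->
  (forall t : R, 0 <= t <= 1 -> P t ->
    exists2 e : R, 0 < e & forall s : R, `|s - t| < e -> P s) ->
  (forall t : R, 0 <= t <= 1 ->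
    (forall e : R, 0 < e -> exists s : R, [/\ 0 <= s <= 1, `|s - t| < e & P s]) -> P t) ->
  forall t : R, 0 <= t <= 1 -> P t.
Proof.
move=> P0 Po Pc t t01.
pose B := [set s : R | 0 <= s <= 1 /\ P s].
suff : B = [set` `[(0:R), 1]] by move=> /seteqP[_ /(_ t)]; rewrite /= in_itv/= => /(_ t01)[].
apply: segment_connected.
- by exists 0; split => //=; rewrite lexx ler01.
- exists (interior [set s | P s]); first exact: open_interior.
  apply/seteqP; split=> s; rewrite /= in_itv/=.
    case=> s01 Ps; split => //; have [e e0 he] := Po _ s01 Ps.
    by apply/nbhs_ballP; exists e => //= s' ss'; apply: he; rewrite distrC.
  by case=> s01 /interior_subset.
exists (closure B); first exact: closed_closure.
apply/seteqP; split=> s; rewrite /= in_itv/=.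
  by case=> s01 Ps; split => //; apply: subset_closure.
case=> s01 clB; split => //; apply: Pc => // e e0.
have [|s' [[s'01 Ps'] ss']] := clB [set s' | `|s' - s| < e].
  by apply/nbhs_ballP; exists e => //= s' ss'; rewrite /= distrC.
by exists s'.
Qed.

Lemma bdry_open D x : open D -> bdry D x <-> closure D x /\ ~ D x.
Proof. by move=> /interior_id oD; rewrite /bdry oD. Qed.

(** A segment leaving an open set meets its boundary. *)
Lemma segment_bdry D x v : open D -> D x -> ~ D (x + v) ->
  exists2 t : R, 0 <= t <= 1 & bdry D (x + t%:C * v).
Proof.
move=> oD Dx nD; apply: contrapT => H; apply: nD.
have -> : x + v = x + (1 : R)%:C * v by rewrite mul1r.
have lip (s t : R) : normc (x + s%:C * v - (x + t%:C * v)) <= `|s - t| * (normc v + 1).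
  have -> : x + s%:C * v - (x + t%:C * v) = (s - t)%:C * v by rewrite rmorphB; ring.
  by rewrite normcM normc_real ler_wpM2l// lerDl.
have v0 : 0 < normc v + 1 by have := normc_ge0 v; lra.
apply: (@segment_clopen (fun t => D (x + t%:C * v))); last by rewrite ler01 lexx.
- by rewrite mul0r addr0.
- move=> t t01 Dt.
  have /nbhs_normc[r r0 hr] : nbhs (x + t%:C * v : C) D := open_nbhs_nbhs (conj oD Dt).
  exists (r / (normc v + 1)); first by rewrite divr_gt0.
  move=> s st; apply: hr; apply: le_lt_trans (lip _ _) _.
  by rewrite -ltr_pdivlMr.
move=> t t01 cl; apply: contrapT => nDt; apply: H; exists t => //.
apply/bdry_open => //; split => // B /nbhs_normc[r r0 hr].
have [|s [s01 st Ds]] := cl (r / (normc v + 1)); first by rewrite divr_gt0.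
exists (x + s%:C * v); split => //; apply: hr; apply: le_lt_trans (lip _ _) _.
by rewrite -ltr_pdivlMr.
Qed.

Lemma bounded_normc D : bounded_set D -> exists2 M : R, 0 < M & forall x, D x -> normc x < M.
Proof.
case=> K [Kr hK].
have KE : K = (complex.Re K)%:C by rewrite RRe_real.
exists (`|complex.Re K| + 2); first by rewrite ltr_wpDl.
move=> x Dx; have : K < (`|complex.Re K| + 1)%:C.
  by rewrite {1}KE ltcR; have := ler_norm (complex.Re K); lra.
move=> /hK /(_ _ Dx) H; have : (normc x)%:C <= (`|complex.Re K| + 1)%:C by exact: H.
by rewrite lecR; lra.
Qed.

Lemma bdry_nonempty D : open D -> bounded_set D -> D 0 -> exists x, bdry D x.
Proof.
move=> oD /bounded_normc[M M0 hM] D0.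
have [|t _ bt] := @segment_bdry D 0 M%:C oD D0; last by exists (0 + t%:C * M%:C).
by rewrite add0r => /hM; rewrite normc_real gtr0_norm ?ltxx.
Qed.

Lemma disc_of_circular_bdry D (a : R) : open D -> bounded_set D -> D 0 ->
  (forall x, bdry D x -> normc x = a) -> 0 < a /\ D = [set x : C | normc (x : R[i]) < a].
Proof.
move=> oD bD D0 Da; have [M M0 hM] := bounded_normc bD.
have a0 : 0 < a.
  have [x bx] := bdry_nonempty oD bD D0; rewrite -(Da _ bx) normc_gt0.
  by apply/eqP => x0; move/(bdry_open _ oD): bx => []; rewrite x0.
have homothety (y : R[i]) (u v : R) : y + u%:C * (v%:C * y) = (1 + u * v)%:C * y.
  by rewrite rmorphD rmorphM rmorph1; ring.
split => //; apply/seteqP; split=> x /=.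
  move=> Dx; rewrite ltNge; apply/negP => ax.
  have x0 : 0 < normc x by apply: lt_le_trans ax.
  pose k := M / normc x.
  have k0 : 0 < k by rewrite divr_gt0.
  have [|t /andP[t0 t1] bt] := @segment_bdry D x (k%:C * x) oD Dx.
    move=> /hM.
    have -> : x + k%:C * x = (1 + 1 * k)%:C * x by rewrite -homothety rmorph1 mul1r.
    rewrite mul1r.
    rewrite normcM normc_real gtr0_norm; last by lra.
    by rewrite mulrDl mul1r /k divfK ?lt0r_neq0//; lra.
  have tk : 0 <= t * k by rewrite mulr_ge0// ltW.
  have := Da _ bt; rewrite homothety normcM normc_real ger0_norm; last by lra.
  rewrite mulrDl mul1r => nE.
  have /eqP : t * k * normc x = 0.
    have : 0 <= t * k * normc x by rewrite mulr_ge0// ltW.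
    lra.
  rewrite mulf_eq0 (gt_eqF x0) orbF mulf_eq0 (gt_eqF k0) orbF => /eqP t00.
  by move/(bdry_open _ oD): bt => []; rewrite t00 mul0r addr0.
move=> xa; apply: contrapT => nD.
have [|t /andP[t0 t1] bt] := @segment_bdry D 0 x oD D0; first by rewrite add0r.
have := Da _ bt; rewrite add0r normcM normc_real ger0_norm// => nE.
have := ler_wpM2r (normc_ge0 x) t1; rewrite nE mul1r; lra.
Qed.

Lemma bdry_disc (a : R) x : 0 < a -> normc x = a ->
  bdry [set x : C | normc (x : R[i]) < a] x.
Proof.
move=> a0 xa; split.
  move=> B /nbhs_normc[r r0 hr].
  pose t := Num.min 1 (r / (2 * a)).
  have t0 : 0 < t by rewrite lt_min ltr01 divr_gt0// mulr_gt0.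
  have t1 : t <= 1 by rewrite ge_min lexx.
  have tr : t <= r / (2 * a) by rewrite ge_min lexx orbT.
  exists ((1 - t)%:C * x); split => /=.
    rewrite normcM normc_real xa ger0_norm; last by lra.
    by rewrite gtr_pMl//; lra.
  apply: hr.
  have -> : (1 - t)%:C * x - x = - (t%:C * x) by rewrite rmorphB rmorph1; ring.
  rewrite normcN normcM normc_real xa (gtr0_norm t0).
  by move: tr; rewrite ler_pdivlMr ?mulr_gt0//; nra.
by move=> /interior_subset /=; rewrite xa ltxx.
Qed.

End Geometry.

(** * Propagation of the tangency *)

Section Tangency.
Variable R : realType.
Local Notation C := (Cpx R).
Local Notation C2 := (Cpx2 R).
Variables (a b : R).
Implicit Types (X Y : C2 -> C2) (p q : R[i] * R[i]).

(** On the torus |x| = a, |y| = b this is [x y] times the Hermitian product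
    expressing complex tangency to the sphere; unlike that product, it is
    holomorphic in q when X is. *)
Definition tangency X q : R[i] :=
  (a ^+ 2)%:C * q.2 * (X q).1 + (b ^+ 2)%:C * q.1 * (X q).2.

Lemma tangencyZ X Y q (k : R[i]) : X q = (k : R[i]) *: Y q -> tangency X q = k * tangency Y q.
Proof. by rewrite /tangency => ->; rewrite /= /GRing.scale/=; ring. Qed.

Lemma differentiable_comp1 X p : differentiable X (p : C2) ->
  differentiable (fun q : C2 => (X q).1 : C) (p : C2).
Proof.
move=> dX.
have d1 := @differentiable_fst R 1 (X p).
have := @differentiable_comp_K R[i] C2 C2 C X (fun v : C2 => (1 : R[i]) * v.1 : C) p dX d1.
apply: eq_differentiable => q; exact: (@mul1r R[i]).
Qed.

Lemma differentiable_comp2 X p : differentiable X (p : C2) ->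
  differentiable (fun q : C2 => (X q).2 : C) (p : C2).
Proof.
move=> dX.
have d1 := @differentiable_snd R 1 (X p).
have := @differentiable_comp_K R[i] C2 C2 C X (fun v : C2 => (1 : R[i]) * v.2 : C) p dX d1.
apply: eq_differentiable => q; exact: (@mul1r R[i]).
Qed.

Lemma differentiable_tangency X p : differentiable X (p : C2) ->
  differentiable (tangency X : C2 -> C) (p : C2).
Proof.
move=> dX; apply: differentiableD_C2.
  apply: (@differentiableM_C2 R (fun q => (a ^+ 2)%:C * q.2) (fun q => (X q).1)).
    exact: differentiable_snd.
  exact: differentiable_comp1.
apply: (@differentiableM_C2 R (fun q => (b ^+ 2)%:C * q.1) (fun q => (X q).2)).
  exact: differentiable_fst.
exact: differentiable_comp2.
Qed.

Lemma complex_tangent_eq0 (p : C2) (v : C2) : complex_sphere_tangent p v ->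
  (p.1 : R[i])^* * v.1 + (p.2 : R[i])^* * v.2 = 0.
Proof.
case; rewrite /sphere_tangent /=.
case: p => [[p1 p1'] [p2 p2']]; case: v => [[v1 v1'] [v2 v2']] /= h1 h2.
apply/eqP; rewrite eq_complex /=; apply/andP; split; apply/eqP; lra.
Qed.

(** On the torus, [a ^+ 2] and [b ^+ 2] are the products of the coordinates with
    their conjugates. *)
Lemma tangency_torus (X : C2 -> C2) p : normc p.1 = a -> normc p.2 = b ->
  complex_sphere_tangent p (X p) -> tangency X p = 0.
Proof.
move=> pa pb /complex_tangent_eq0 E.
have sq (z : R[i]) (k : R) : normc z = k -> (k ^+ 2)%:C = z * z^*.
  by move=> <-; rewrite -sqr_normc norm_normc rmorphXn.
rewrite /tangency (sq _ _ pa) (sq _ _ pb).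
transitivity (p.1 * p.2 * (((p.1 : R[i])^* * (X p).1 + (p.2 : R[i])^* * (X p).2) : R[i])); first by ring.
by rewrite E mulr0.
Qed.

Variables (U : set C2) (F : foliation U).

Lemma chart_local_generator (i : chart F) p : chart_dom i p ->
  local_generator F p (chart_gen i).
Proof.
move=> ip; exists (chart_dom i); split => //.
- by move=> q iq; rewrite -(chart_cover F); exists i.
- exact: chart_gen_holomorphic.
move=> j; have [g [hg1 hg2]] := chart_gen_compatible i j.
by exists g.
Qed.

(** The points near which the tangency function of a generator vanishes
    identically.  By [tangent_near_generator] the choice of the generator is
    irrelevant. *)
Definition tangent_near p := exists2 i : chart F, chart_dom i p &
  \forall q \near (p : C2), tangency (chart_gen i) q = 0.

Lemma tangent_near_generator p X : tangent_near p -> local_generator F p X ->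
  \forall q \near (p : C2), tangency X q = 0.
Proof.
case=> i ip i0 [W [Wp WU hX hW]]; have [g [[og _] hg]] := hW i.
have : \forall q \near (p : C2), (W `&` chart_dom i) q by exact: open_nbhs_nbhs.
apply: filterS2 i0 => q q0 [Wq iq]; have [_ E] := hg q Wq iq.
by rewrite (tangencyZ E) q0 mulr0.
Qed.

Lemma tangent_near_open p : tangent_near p -> \forall q \near (p : C2), tangent_near q.
Proof.
case=> i ip i0; have [oi _] := chart_gen_holomorphic i.
have : \forall q \near (p : C2), chart_dom i q by exact: open_nbhs_nbhs.
move: i0 => /nbhs_interior i0.
by apply: filterS2 i0 => q i0q iq; exists i.
Qed.

Lemma chart_identity_box (i : chart F) p : chart_dom i p ->
  exists2 e : R, 0 < e & forall E1 E2 : set C, infinite_set E1 -> infinite_set E2 ->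
    (forall x : R[i], E1 x -> normc (x - p.1) < e) ->
    (forall y : R[i], E2 y -> normc (y - p.2) < e) ->
    (forall x y : R[i], E1 x -> E2 y -> tangency (chart_gen i) (x, y) = 0) ->
    tangent_near p.
Proof.
move=> ip; have [oi di] := chart_gen_holomorphic i.
have /identity_box[e e0 he] :
    \forall q \near (p : C2), differentiable (tangency (chart_gen i) : C2 -> C) q.
  have : \forall q \near (p : C2), chart_dom i q by exact: open_nbhs_nbhs.
  by apply: filterS => q /di; exact: differentiable_tangency.
exists e => // E1 E2 i1 i2 s1 s2 h0; exists i => //.
by apply/nbhs2P; exists e => //; exact: (he E1 E2).
Qed.

Lemma tangent_near_closed p : U p ->
  (forall d : R, 0 < d -> exists q, [/\ normc (q.1 - p.1) < d, normc (q.2 - p.2) < d &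
     tangent_near q]) -> tangent_near p.
Proof.
rewrite -{1}(chart_cover F) => -[i _ ip] H.
have [e e0 he] := chart_identity_box ip.
have [oi _] := chart_gen_holomorphic i.
have /nbhs2P[d d0 hd] : nbhs (p : C2) (chart_dom i) by exact: open_nbhs_nbhs.
have [|q []] := H (Num.min e d); first by rewrite lt_min e0.
rewrite !lt_min => /andP[q1e q1d] /andP[q2e q2d] Vq.
have iq : chart_dom i q by have := hd q.1 q.2 q1d q2d; rewrite -surjective_pairing.
have /nbhs2P[r r0 hr] := tangent_near_generator Vq (chart_local_generator iq).
pose t := Num.min r (Num.min (e - normc (q.1 - p.1)) (e - normc (q.2 - p.2))).
have t0 : 0 < t by rewrite !lt_min r0 !subr_gt0 q1e.
apply: (he [set z : C | normc (z - q.1 : R[i]) < t] [set z : C | normc (z - q.2 : R[i]) < t]).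
- exact: infinite_disc.
- exact: infinite_disc.
- move=> x /=; rewrite !lt_min => /and3P[_ x1 _].
  by have := le_normcD (x - q.1) (q.1 - p.1); rewrite addrA subrK; lra.
- move=> x /=; rewrite !lt_min => /and3P[_ _ x1].
  by have := le_normcD (x - q.2) (q.2 - p.2); rewrite addrA subrK; lra.
move=> x y /=; rewrite !lt_min => /and3P[x1 _ _] /and3P[y1 _ _]; exact: hr.
Qed.

(** Tangency along the torus propagates to the origin along a segment of the
    closed bidisc. *)
Lemma tangent_near_origin (r : R) : 0 < a -> 0 < b ->
  (forall x y : R[i], normc x <= a -> normc y <= b -> U (x, y)) ->
  (forall x y : R[i], normc x = a -> normc y = b -> complex_tangent_at F r (x, y)) ->
  tangent_near (0, 0).
Proof.
move=> a0 b0 hU hT.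
pose g (t : R) : R[i] * R[i] := (((1 - t) * a)%:C, ((1 - t) * b)%:C).
have -> : (0, 0) = g 1 by rewrite /g subrr !mul0r.
have gU t : 0 <= t <= 1 -> U (g t).
  move=> /andP[t0 t1]; have t10 : 0 <= 1 - t by lra.
  have scale (k : R) : 0 < k -> normc (((1 - t) * k)%:C : R[i]) <= k.
    move=> k0; rewrite normc_real ger0_norm; last by rewrite mulr_ge0// ltW.
    by rewrite ger_pMl//; lra.
  by apply: hU; exact: scale.
have gs s t : normc ((g s).1 - (g t).1) = `|s - t| * a /\
    normc ((g s).2 - (g t).2) = `|s - t| * b.
  have diff (k : R) : 0 < k ->
      normc (((1 - s) * k)%:C - ((1 - t) * k)%:C : R[i]) = `|s - t| * k.
    move=> k0; have -> : ((1 - s) * k)%:C - ((1 - t) * k)%:C = ((t - s) * k)%:C :> R[i].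
      by rewrite -rmorphB; congr _%:C; ring.
    by rewrite normc_real normrM (gtr0_norm k0) distrC.
  by split; exact: diff.
apply: (@segment_clopen R (fun t => tangent_near (g t))); last by rewrite ler01 lexx.
- have -> : g 0 = (a%:C, b%:C) by rewrite /g subr0 !mul1r.
  have na : normc (a%:C : R[i]) = a by rewrite normc_real gtr0_norm.
  have nb : normc (b%:C : R[i]) = b by rewrite normc_real gtr0_norm.
  have [Up _ _] := hT _ _ na nb.
  move: (Up); rewrite -{1}(chart_cover F) => -[i _ ip].
  have [e e0 he] := chart_identity_box ip.
  have [oi _] := chart_gen_holomorphic i.
  have /nbhs2P[d d0 hd] : nbhs ((a%:C, b%:C) : C2) (chart_dom i) by exact: open_nbhs_nbhs.
  have ed0 : 0 < Num.min e d by rewrite lt_min e0.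
  set m := Num.min e d in ed0.
  apply: (he [set z : C | normc (z : R[i]) = a /\ normc (z - a%:C : R[i]) < m]
             [set z : C | normc (z : R[i]) = b /\ normc (z - b%:C : R[i]) < m]).
  + exact: infinite_arc.
  + exact: infinite_arc.
  + by move=> x [_]; rewrite lt_min => /andP[].
  + by move=> x [_]; rewrite lt_min => /andP[].
  move=> x y [xa]; rewrite lt_min => /andP[_ xd] [yb]; rewrite lt_min => /andP[_ yd].
  apply: tangency_torus => //; have [_ _] := hT _ _ xa yb; apply.
  exists (chart_gen i); first by apply: chart_local_generator; exact: hd.
  by exists 1; rewrite scale1r.
- move=> t t01 /tangent_near_open/nbhs2P[e e0 he].
  exists (e / (a + b)); first by rewrite divr_gt0// addr_gt0.
  move=> s; rewrite ltr_pdivlMr ?addr_gt0// mulrDr => st; have [g1 g2] := gs s t.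
  have h1 : 0 <= `|s - t| * a by rewrite mulr_ge0// ltW.
  have h2 : 0 <= `|s - t| * b by rewrite mulr_ge0// ltW.
  rewrite [g s]surjective_pairing; apply: he; rewrite ?g1 ?g2; lra.
move=> t t01 H; apply: tangent_near_closed; first exact: gU.
move=> d d0; have [|s [s01 st Vs]] := H (d / (a + b)); first by rewrite divr_gt0// addr_gt0.
move: st; rewrite ltr_pdivlMr ?addr_gt0// mulrDr => st; have [g1 g2] := gs s t.
have h1 : 0 <= `|s - t| * a by rewrite mulr_ge0// ltW.
have h2 : 0 <= `|s - t| * b by rewrite mulr_ge0// ltW.
by exists (g s); split=> //; rewrite ?g1 ?g2; lra.
Qed.

End Tangency.

(** * The unit factor *)

Section UnitFactor.
Variable R : realType.
Local Notation C := (Cpx R).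
Local Notation C2 := (Cpx2 R).

(** A multiple of the linear field by a function vanishing at 0 has a singular
    linear part. *)
Lemma diff_multiple_linear_field (a b : R) (Y : C2 -> C2) (m : C2 -> C) :
  differentiable Y (0 : C2) -> {for (0 : C2), continuous m} -> m 0 = 0 ->
  (\forall p \near (0 : C2), Y p = m p *: linear_field a b p) ->
  ~ bijective ('d Y (0 : C2) : C2 -> C2).
Proof.
move=> dY cm m0 hY bij.
have frac (n k : R) : 0 < n -> 0 <= k -> n / (3 * (k + 1)) * k <= n / 3.
  move=> n0 k0; have k1 : 0 < k + 1 by lra.
  rewrite mulrAC ler_pdivrMr ?mulr_gt0//.
  have -> : n / 3 * (3 * (k + 1)) = n * (k + 1) by field.
  by rewrite ler_pM2l//; lra.
pose w := 'd Y (0 : C2) (1, 0).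
have w0 : w != 0.
  apply/eqP => w0; have : ((1, 0) : C2) = 0.
    by apply: (bij_inj bij); rewrite -/w w0 linear0.
  by case=> /eqP; rewrite oner_eq0.
pose n := complex.Re `|w|.
have nE : `|w| = n%:C by rewrite RRe_real.
have n0 : 0 < n by rewrite -ltcR -nE normr_gt0.
pose k := normc ((b ^+ 2)%:C : R[i]).
have k0 : 0 <= k by exact: normc_ge0.
pose c := n / (3 * (k + 1)).
have c0 : 0 < c by rewrite divr_gt0// mulr_gt0//; lra.
have e0 : 0 < (n / 3)%:C by rewrite ltcR divr_gt0.
have /nbhs2P[r1 r10 h1] := differentiable_nearP dY e0.
have /nbhs2P[r2 r20 h2] := hY.
have [r3 r30 h3] := (@continuous2P R m 0).1 cm _ c0.
pose rho := Num.min r1 (Num.min r2 r3) / 2.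
have mn0 : 0 < Num.min r1 (Num.min r2 r3) by rewrite !lt_min r10 r20.
have rho0 : 0 < rho by rewrite divr_gt0.
have : rho < Num.min r1 (Num.min r2 r3) by rewrite /rho; lra.
rewrite !lt_min => /and3P[rr1 rr2 rr3].
have nx : normc (rho%:C : R[i]) = rho by rewrite normc_real gtr0_norm.
have z0 : normc (0 : R[i]) = 0 by exact: normc0.
have := h1 rho%:C 0; have := h2 rho%:C 0; have := h3 rho%:C 0.
rewrite !subr0 nx z0 m0 subr0 => /(_ rr3 r30) M1 /(_ rr2 r20) M2 /(_ rr1 r10).
have Y0 : Y 0 = 0 by rewrite (nbhs_singleton hY) m0 scale0r.
rewrite addr0 Y0 subr0.
have -> : 'd Y (0 : C2) (rho%:C, 0) = rho%:C *: w.
  rewrite -linearZ; congr ('d Y _ _).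
  by congr (_, _); rewrite /= /GRing.scale/= ?mulr0 ?mulr1.
have nv : `|((rho%:C, 0) : C2)| = rho%:C.
  by rewrite prod_normE/= normr0 maxElt normr_lt0 norm_normc nx.
rewrite nv M2 => H.
have nL : `|linear_field a b (rho%:C, 0)| = (k * rho)%:C.
  by rewrite prod_normE/= mulr0 normr0 maxElt normr_lt0 norm_normc normcM nx.
have : rho%:C * n%:C <= (n / 3)%:C * rho%:C + (c * (k * rho))%:C.
  have -> : rho%:C * n%:C = `|rho%:C *: w| by rewrite normrZ nE norm_normc nx.
  rewrite -[in leLHS](subKr (m (rho%:C, 0) *: linear_field a b (rho%:C, 0)) (rho%:C *: w)).
  apply: le_trans (ler_normB _ _) _; rewrite addrC; apply: lerD => //.
  rewrite normrZ nL norm_normc -rmorphM lecR ler_wpM2r//; last exact: ltW.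
  by rewrite mulr_ge0// ltW.
rewrite -!rmorphM -rmorphD lecR.
have : c * (k * rho) <= n / 3 * rho.
  by rewrite mulrA ler_wpM2r ?(ltW rho0)// frac.
have := mulr_gt0 n0 rho0; lra.
Qed.

End UnitFactor.

Theorem proposition10 (R : realType) (r : R) (D1 D2 : set (Cpx R))
    (U : set (Cpx2 R)) (F : foliation U) :
  0 < r ->
  planar_domain D1 -> planar_domain D2 -> D1 0 -> D2 0 ->
  bdry D1 `*` bdry D2 `<=` sphere r ->
  open U -> closure (D1 `*` D2) `<=` U ->
  (forall p, (bdry D1 `*` bdry D2) p -> complex_tangent_at F r p) ->
  exists a b : R,
    [/\ 0 < a, 0 < b, a ^+ 2 + b ^+ 2 = r ^+ 2,
        D1 = [set x : Cpx R | (`|x| : R[i]) < a%:C] /\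
        D2 = [set y : Cpx R | (`|y| : R[i]) < b%:C] &
        forall X : Cpx2 R -> Cpx2 R, local_generator F 0 X ->
          exists h : Cpx2 R -> Cpx R,
            [/\ holomorphic_germ 0 h,
                \forall p \near (0 : Cpx2 R), X p = h p *: linear_field a b p &
                isolated_singularity F 0 -> nondegenerate_singularity F 0 ->
                  unit_germ 0 h]].
Proof.
move=> r0 [oD1 _ bD1] [oD2 _ bD2] D10 D20 hS oU hU hT.
have [x0 bx0] := bdry_nonempty oD1 bD1 D10.
have [y0 by0] := bdry_nonempty oD2 bD2 D20.
pose a := normc (x0 : R[i]); pose b := normc (y0 : R[i]).
have radii (x y : R[i]) : bdry D1 x -> bdry D2 y -> normc x ^+ 2 + normc y ^+ 2 = r ^+ 2.
  move=> bx by_; apply: (@complexI R); rewrite rmorphD !rmorphXn.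
  by rewrite -[RHS]rmorphXn; exact: (hS (x, y) (conj bx by_)).
have ab := radii _ _ bx0 by0; rewrite -/a -/b in ab.
have h1 (x : R[i]) : bdry D1 x -> normc x = a.
  move=> bx; have := radii _ _ bx by0; rewrite -ab => /addIr /eqP.
  by rewrite eqrXn2 ?normc_ge0// => /eqP.
have h2 (y : R[i]) : bdry D2 y -> normc y = b.
  move=> by_; have := radii _ _ bx0 by_; rewrite -ab => /addrI /eqP.
  by rewrite eqrXn2 ?normc_ge0// => /eqP.
have [a0 D1E] := disc_of_circular_bdry oD1 bD1 D10 h1.
have [b0 D2E] := disc_of_circular_bdry oD2 bD2 D20 h2.
have bd1 (x : R[i]) : normc x = a -> bdry D1 x by move=> xa; rewrite D1E; exact: bdry_disc.
have bd2 (x : R[i]) : normc x = b -> bdry D2 x by move=> xa; rewrite D2E; exact: bdry_disc.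
have cl1 (x : R[i]) : normc x <= a -> closure D1 x.
  rewrite le_eqVlt => /predU1P[/bd1[]//|xa]; apply: subset_closure; by rewrite D1E.
have cl2 (x : R[i]) : normc x <= b -> closure D2 x.
  rewrite le_eqVlt => /predU1P[/bd2[]//|xa]; apply: subset_closure; by rewrite D2E.
have bidisc (x y : R[i]) : normc x <= a -> normc y <= b -> U (x, y).
  move=> xa yb; apply: hU => B [[B1 B2] /= [n1 n2] sB].
  have [u [D1u B1u]] := cl1 _ xa _ n1; have [v [D2v B2v]] := cl2 _ yb _ n2.
  by exists (u, v); split => //; exact: sB.
have T0 : tangent_near a b F (0, 0).
  apply: (@tangent_near_origin R a b U F r) => // x y xa yb.
  by apply: hT; split; [exact: bd1|exact: bd2].
exists a, b; split => //.
  by split; [rewrite D1E|rewrite D2E]; apply/seteqP; split=> x /=; rewrite norm_normc ltcR.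
move=> X hX.
have tX := tangent_near_generator T0 hX.
have [W [W0 WU [oW dW] hW]] := hX.
have nW : \forall p \near ((0, 0) : Cpx2 R), W p by exact: open_nbhs_nbhs.
have /nbhs2P[e e0 he] : \forall p \near ((0, 0) : Cpx2 R), W p /\ tangency a b X p = 0.
  by apply: filterS2 nW tX.
have A0 : (b ^+ 2)%:C != 0 :> R[i].
  by rewrite -normc_gt0 normc_real normr_gt0 expf_neq0// lt0r_neq0.
have B0 : (a ^+ 2)%:C != 0 :> R[i].
  by rewrite -normc_gt0 normc_real normr_gt0 expf_neq0// lt0r_neq0.
have [x y xe ye|h [e' e'0 hh]] :=
    @coordinate_syzygy R (fun q => (X q).1) (fun q => (X q).2) _ _ e A0 B0 e0.
  have [] := he x y; cbn [fst snd]; rewrite ?subr0// => Wxy Txy.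
  split; [| |exact: Txy].
    by apply: differentiable_comp1; exact: dW.
  by apply: differentiable_comp2; exact: dW.
have hol : \forall p \near ((0, 0) : Cpx2 R), differentiable (h : Cpx2 R -> Cpx R) p.
  apply/nbhs2P; exists e' => // x y; cbn [fst snd]; rewrite !subr0 => xe ye.
  by have [] := hh x y xe ye.
have XE : \forall p \near ((0, 0) : Cpx2 R), X p = (h p : R[i]) *: linear_field a b p.
  apply/nbhs2P; exists e' => // x y; cbn [fst snd]; rewrite !subr0 => xe ye.
  have [_ h1' h2'] := hh x y xe ye.
  by rewrite [X _]surjective_pairing h1' h2'.
exists h; split => // _ [Y hY bY]; split => //.
apply/eqP => h00.
have : U (0, 0) by apply: bidisc; rewrite normc0 ltW.
rewrite -{1}(chart_cover F) => -[i _ i0].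
have [g1 [[og1 dg1] hg1]] := hW i.
have [W' [W'0 W'U [oW' dW'] hW']] := hY.
have [g2 [[og2 dg2] hg2]] := hW' i.
have g10 : g1 0 != 0 by have [] := hg1 0 W0 i0.
have dg10 := dg1 0 (conj W0 i0).
have dg20 := dg2 0 (conj W'0 i0).
(* Y and X differ by the factor g2 / g1, so Y is the multiple of the linear
   field by g2 / g1 * h, which vanishes at 0 with h *)
apply: (@diff_multiple_linear_field R a b Y (fun q => (g2 q : R[i]) * (g1 q)^-1 * h q)) bY.
- exact: dW'.
- apply: differentiable_continuous.
  apply: (@differentiableM_C2 R (fun q => (g2 q : R[i]) * (g1 q)^-1) h 0); last first.
    exact: nbhs_singleton hol.
  apply: (@differentiableM_C2 R g2 (fun q => (g1 q)^-1) 0 dg20).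
  exact: (@differentiableV_C2 R g1 0 dg10 g10).
- by rewrite h00 mulr0.
have n1 : \forall p \near ((0, 0) : Cpx2 R), (W `&` chart_dom i) p by exact: open_nbhs_nbhs.
have n2 : \forall p \near ((0, 0) : Cpx2 R), (W' `&` chart_dom i) p by exact: open_nbhs_nbhs.
near=> p.
have [Wp ip] : (W `&` chart_dom i) p by near: p.
have [W'p _] : (W' `&` chart_dom i) p by near: p.
have Xp : X p = (h p : R[i]) *: linear_field a b p by near: p.
have [g1p X1] := hg1 p Wp ip; have [_ Y2] := hg2 p W'p ip.
rewrite -scalerA -Xp X1 Y2 scalerA.
congr (_ *: _); rewrite -mulrA mulVf ?mulr1//.
Unshelve. all: by end_near. Qed.
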